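(* Let $p \geq 1$ and $s_1, s_2 \geq 1$ be integers. Let $b_n = b_n^{(s_1)}$ ($n\ge -2$) be defined by $b_n = b_{n-1}+b_{n-2}$ for $n \geq 0$, $b_{-2} = 2^{s_1}$, $b_{-1} = 2^{s_1-1}(s_1+2)$, and set $$a := 2^{1-s_1}\left(2 b_{2p-3}^{(s_1)} + s_2\, b_{2p-4}^{(s_1)}\right).$$ Then the sandpile group of the cone over the bi-coconut tree $T(p,s_1,s_2)$ satisfies $$K(\mathrm{Cone}(T(p,s_1,s_2))) \cong \begin{cases} \mathbb{Z}_2^{s_1+s_2-2} \oplus \mathbb{Z}_a & \text{if } p \equiv 1 \pmod 3,\\ \mathbb{Z}_2^{s_1+s_2-3} \oplus \mathbb{Z}_{2a} & \text{if } s_1 \text{ or } s_2 \text{ is odd and } p \not\equiv 1 \pmod 3,\\ \mathbb{Z}_2^{s_1+s_2-4} \oplus \mathbb{Z}_4 \oplus \mathbb{Z}_a & \text{if } s_1 \text{ and } s_2 \text{ are both even and } p \not\equiv 1 \pmod 3.\end{cases}$$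
   Context: For a graph $G$ on vertex set $\{v_1,\dots,v_n\}$, the cone $\mathrm{Cone}(G)$ is obtained by adding a new vertex $v_0$ and one edge $\{v_0,v_i\}$ for each $i$. For positive integers $p,s_1,s_2$, the bi-coconut tree $T(p,s_1,s_2)$ is obtained from a path on $p$ vertices $\pi_1,\dots,\pi_p$ by attaching $s_1$ new leaves to $\pi_1$ and $s_2$ new leaves to $\pi_p$. For a connected graph $G$ with Laplacian $L_G = D - A$ ($D$ the diagonal degree matrix, $A$ the adjacency matrix), the sandpile group $K(G)$ is the torsion subgroup of $\mathrm{coker}(L_G: \mathbb{Z}^V \to \mathbb{Z}^V)$; equivalently $K(G) = \mathbb{Z}^{n-1}/\mathrm{im}(\overline{L_G})$, where $\overline{L_G}$ is obtained from $L_G$ by deleting the row and column of any one vertex. Here $\mathbb{Z}_m = \mathbb{Z}/m\mathbb{Z}$ and $\mathbb{Z}_2^k$ denotes the direct sum of $k$ copies of $\mathbb{Z}_2$.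
   Formalization: For s_1 = s_2 = 1 and p ≢ 1 (mod 3) the exponent s_1+s_2-3 is -1, so the stated group is undefined; there the claim is read as Z_2 ⊕ K ≅ Z_{2a}. All other cases are as stated. *)

(* Defs.v *)
From HB Require Import structures.
From mathcomp Require Export all_boot all_order all_algebra.
From mathcomp Require Import boolp.

Set Implicit Arguments.
Unset Strict Implicit.
Unset Printing Implicit Defensive.

Import Order.TTheory GRing.Theory Num.Theory.
Local Open Scope ring_scope.

Record sgraph := SGraph {
  vertex :> finType;
  edge : rel vertex;
  edge_sym : symmetric edge;
  edge_irr : irreflexive edge
}.

Section Cone.
Variable G : sgraph.

(* None is the apex v_0. *)
Definition cone_edge (x y : option G) : bool :=
  match x, y with
  | Some u, Some v => edge u v
  | None, None => false
  | _, _ => true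
  end.

Lemma cone_edge_sym : symmetric cone_edge.
Proof. by move=> [u|] [v|] //=; exact: edge_sym. Qed.

Lemma cone_edge_irr : irreflexive cone_edge.
Proof. by move=> [u|] //=; exact: edge_irr. Qed.

Definition Cone : sgraph := SGraph cone_edge_sym cone_edge_irr.
End Cone.

Section BiCoconut.
Variables p s1 s2 : nat.

(* The path vertex pi_i is inl (i - 1); the s1 leaves attached to pi_1 are
   inr (inl _) and the s2 leaves attached to pi_p are inr (inr _). *)
Definition bicoconut_vertex : finType := ('I_p + ('I_s1 + 'I_s2))%type.

Definition bicoconut_edge (x y : bicoconut_vertex) : bool :=
  match x, y with
  | inl i, inl j => (i.+1 == j :> nat) || (j.+1 == i :> nat)
  | inl i, inr (inl _) | inr (inl _), inl i => i == 0 :> nat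
  | inl i, inr (inr _) | inr (inr _), inl i => i.+1 == p
  | inr _, inr _ => false
  end.

Lemma bicoconut_edge_sym : symmetric bicoconut_edge.
Proof. by move=> [i|[i|i]] [j|[j|j]] //=; rewrite orbC. Qed.

Lemma bicoconut_edge_irr : irreflexive bicoconut_edge.
Proof. by move=> [i|[i|i]] //=; rewrite orbb; apply/negbTE; rewrite gtn_eqF. Qed.

Definition bicoconut : sgraph := SGraph bicoconut_edge_sym bicoconut_edge_irr.
End BiCoconut.

Section Laplacian.
Variable G : sgraph.

Definition degree (v : G) : nat := #|[set w | edge v w]|.

Definition adjacency_mx : 'M[int]_#|G| :=
  \matrix_(i, j) (edge (enum_val i) (enum_val j))%:R.

Definition degree_mx : 'M[int]_#|G| :=
  diag_mx (\row_i (degree (enum_val i))%:R).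

Definition laplacian : 'M[int]_#|G| := degree_mx - adjacency_mx.
End Laplacian.

Section Cokernel.
Variables (m n : nat) (A : 'M[int]_(m, n)).

Definition int_im : {pred 'cV[int]_m} :=
  [pred v : 'cV[int]_m | `[< exists w : 'cV[int]_n, v = A *m w >]].

Lemma int_im_zmod_closed : zmod_closed int_im.
Proof.
split; first by apply/asboolP; exists 0; rewrite mulmx0.
move=> u v /asboolP [x ->] /asboolP [y ->]; apply/asboolP.
by exists (x - y); rewrite mulmxBr.
Qed.

HB.instance Definition _ :=
  GRing.isZmodClosed.Build 'cV[int]_m int_im int_im_zmod_closed.

Definition int_coker : zmodType := Quotient.quot int_im.
End Cokernel.

Section Torsion.
Variable U : zmodType.

Definition is_torsion : {pred U} :=
  [pred x : U | `[< exists2 n : nat, (0 < n)%N & x *+ n = 0 >]].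

Lemma is_torsion_zmod_closed : zmod_closed is_torsion.
Proof.
split; first by apply/asboolP; exists 1%N.
move=> x y /asboolP [m m0 xm] /asboolP [n n0 yn]; apply/asboolP.
exists (m * n)%N; first by rewrite muln_gt0 m0.
by rewrite mulrnBl mulrnA xm mulnC mulrnA yn !mul0rn subrr.
Qed.

HB.instance Definition _ :=
  GRing.isZmodClosed.Build U is_torsion is_torsion_zmod_closed.

Record torsion : Type := Torsion {
  torsion_val :> U;
  torsion_valP : torsion_val \in is_torsion
}.

HB.instance Definition _ := [isSub for torsion_val].
HB.instance Definition _ := [Choice of torsion by <:].
HB.instance Definition _ := [SubChoice_isSubZmodule of torsion by <:].
End Torsion.

Definition sandpile (G : sgraph) : zmodType := torsion (int_coker (laplacian G)).

Definition zmod_iso (U V : zmodType) : Prop :=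
  exists f : {additive U -> V}, bijective f.

(* K is isomorphic to Z_2^k (+) H. A negative exponent k is read by moving the
   factor Z_2^(-k) to the other side: Z_2^(-k) (+) K is isomorphic to H. *)
Definition iso_Z2pow_sum (K : zmodType) (k : int) (H : zmodType) : Prop :=
  match k with
  | Posz n => zmod_iso K ('rV['Z_2]_n * H)%type
  | Negz n => zmod_iso ('rV['Z_2]_n.+1 * K)%type H
  end.

(* coconut_bnat s m is b_{m-2}. *)
Fixpoint coconut_bnat (s m : nat) : nat :=
  match m with
  | 0 => 2 ^ s
  | 1 => 2 ^ (s - 1) * (s + 2)
  | (m'.+1 as m1).+1 => coconut_bnat s m1 + coconut_bnat s m'
  end%N.

(* Only meaningful for n >= -2. *)
Definition coconut_b (s : nat) (n : int) : nat := coconut_bnat s `|(n + 2)%R|%N.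

(* The division is exact when s1 > 0, see coconut_aE. *)
Definition coconut_a (p s1 s2 : nat) : nat :=
  ((2 * (2 * coconut_b s1 (2 * p%:Z - 3)%R + s2 * coconut_b s1 (2 * p%:Z - 4)%R))
     %/ 2 ^ s1)%N.

Lemma coconut_b_init2 s : coconut_b s (-2) = (2 ^ s)%N.
Proof. by []. Qed.

Lemma coconut_b_init1 s : coconut_b s (-1) = (2 ^ (s - 1) * (s + 2))%N.
Proof. by []. Qed.

Lemma coconut_b_rec s (n : int) : 0 <= n ->
  coconut_b s n = (coconut_b s (n - 1) + coconut_b s (n - 2))%N.
Proof.
case: n => // n _; rewrite /coconut_b subrK.
have -> : n%:Z - 1 + 2 = n.+1%:Z by rewrite -addrA -[in RHS]addn1 PoszD.
by rewrite -PoszD addn2.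
Qed.

Lemma dvdn_coconut_b s n : (0 < s)%N -> (2 ^ (s - 1) %| coconut_b s n)%N.
Proof.
case: s => // s _; rewrite /coconut_b subSS subn0.
suff H m : (2 ^ s %| coconut_bnat s.+1 m)%N && (2 ^ s %| coconut_bnat s.+1 m.+1)%N.
  by have /andP[] := H `|(n + 2)%R|%N.
elim: m => [|m /andP [h1 h2]].
  by rewrite /= subSS subn0 dvdn_mulr // expnS dvdn_mull.
by rewrite h2 /= dvdn_add.
Qed.

Lemma coconut_aE p s1 s2 : (0 < s1)%N ->
  (coconut_a p s1 s2)%:R = (2 : rat) ^ (1 - s1%:Z) *
    (2 * (coconut_b s1 (2 * p%:Z - 3))%:R
     + s2%:R * (coconut_b s1 (2 * p%:Z - 4))%:R).
Proof.
move=> s0; set x := coconut_b s1 _; set y := coconut_b s1 (_ - 4).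
have dv : (2 ^ s1 %| 2 * (2 * x + s2 * y))%N.
  rewrite -[in X in (X %| _)%N](subnK s0) addn1 expnS dvdn_pmul2l //.
  by apply: dvdn_add; apply: dvdn_mull; apply: dvdn_coconut_b.
have n0 : (2 : rat) ^+ s1 != 0 by rewrite expf_neq0.
have E : (coconut_a p s1 s2 * 2 ^ s1 = 2 * (2 * x + s2 * y))%N by exact: divnK.
have ER : (coconut_a p s1 s2)%:R * 2 ^+ s1 = 2 * (2 * x%:R + s2%:R * y%:R) :> rat.
  by rewrite -natrX -natrM E natrM natrD !natrM.
apply: (mulIf n0); rewrite ER.
by rewrite mulrAC expfzDr // expr1z -exprnN divfK.
Qed.

Lemma leq_coconut_bnat s m : (0 < s)%N -> (2 ^ s <= coconut_bnat s m)%N.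
Proof.
case: s => // s _.
suff /andP[] : (2 ^ s.+1 <= coconut_bnat s.+1 m)%N
            && (2 ^ s.+1 <= coconut_bnat s.+1 m.+1)%N by [].
elim: m => [|m /andP [h1 h2]].
  by rewrite /= leqnn subSS subn0 expnSr leq_mul2l leq_addl orbT.
by rewrite h2 /= (leq_trans h2) // leq_addr.
Qed.

(* Hence 'Z_a and 'Z_(2 * a) are the cyclic groups of orders a and 2 * a. *)
Lemma coconut_a_gt1 p s1 s2 : (0 < s1)%N -> (1 < coconut_a p s1 s2)%N.
Proof.
move=> s0; rewrite /coconut_a leq_divRL ?expn_gt0 // leq_mul2l /=.
apply: leq_trans (leq_addr _ _).
by apply: leq_trans (leq_coconut_bnat _ s0) (leq_pmull _ _).
Qed.

(* Main.v *)
From HB Require Import structures.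
Require Import Defs.
From mathcomp Require Import all_boot all_order all_algebra.
From mathcomp Require Import boolp ring zify.
From mathcomp Require Import ring_quotient generic_quotient.

Set Implicit Arguments.
Unset Strict Implicit.
Unset Printing Implicit Defensive.

Import Order.TTheory GRing.Theory Num.Theory.
Local Open Scope ring_scope.

(* With the apex sent to 0, the relation at an inner path vertex reads
   pi_(k+1) = 3 pi_k - pi_(k-1). Hence pi_1 and a virtual predecessor pi_0
   determine the whole path, with even-indexed Fibonacci coefficients, and the
   sandpile group is generated by the leaves x_i at pi_1 and y_j at pi_p,
   subject to 2 x_i = pi_1, 2 y_j = pi_p and one relation for each of the sums
   of the x_i and of the y_j. Only E = F_(2p-2) and F = F_(2p) enter this
   presentation, and E is even exactly when p = 1 mod 3. Differences of leaves
   on the same side have order 2; according to the parities of E, s1 and s2, a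
   suitable choice of one or two further generators turns the presentation into
   that of a direct sum of cyclic groups. *)

(** * Linear identities in abelian groups *)

(** No integer matrix is ever reduced. A candidate group is recognised by the maps out of it: every
    solution of the leaf relations in an abelian group [Q] must extend to a map into [Q]. What
    remains are linear identities between a few elements, each certified by the multiples of the
    hypotheses that produce it. The number [a] is a determinant: doubling the two leaf sums leaves
    two relations in pi_0 and pi_1 alone. The parities decide which elements can be halved. For E
    even, pi_p is twice a multiple of x_1. For E and s1 odd, pi_1 is four times some element, which
    doubles the cyclic factor. For E odd and s1, s2 even, y_1 differs from a multiple of x_1 by an
    element of order 4. The smallest trees break the pattern: with a single leaf at pi_p, no second
    leaf can absorb an element of order 2, and the Chinese remainder theorem for odd [a] restores
    the stated form. *)

Inductive zexp :=
  | ZVar of nat | ZZero | ZAdd of zexp & zexp | ZOpp of zexp | ZMul of zexp & int.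

Fixpoint zeval (Q : zmodType) (env : seq Q) (e : zexp) : Q :=
  match e with
  | ZVar k => env`_k
  | ZZero => 0
  | ZAdd e1 e2 => zeval env e1 + zeval env e2
  | ZOpp e1 => - zeval env e1
  | ZMul e1 n => zeval env e1 *~ n
  end.

Fixpoint zcoef (i : nat) (e : zexp) : int :=
  match e with
  | ZVar k => if eqn k i then 1 else 0
  | ZZero => 0
  | ZAdd e1 e2 => zcoef i e1 + zcoef i e2
  | ZOpp e1 => - zcoef i e1
  | ZMul e1 n => zcoef i e1 * n
  end.

Lemma zeval_sum (Q : zmodType) (env : seq Q) (e : zexp) :
  zeval env e = \sum_(i < size env) env`_i *~ zcoef i e.
Proof.
elim: e => [k||e1 IH1 e2 IH2|e IH|e IH n] /=.
- case: (ltnP k (size env)) => hk.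
    rewrite (bigD1 (Ordinal hk)) //= -[eqn k k]/(k == k) eqxx mulr1z big1 ?addr0 // => i ik.
    rewrite -[eqn k i]/(k == i :> nat) ifN // eq_sym.
    by apply: contraNneq ik => ik; apply/eqP/val_inj.
  rewrite nth_default // big1 // => i _; rewrite -[eqn k i]/(k == i :> nat) ifN //.
  by rewrite neq_ltn (leq_trans (ltn_ord i) hk) orbT.
- by rewrite big1 // => i _; rewrite mulr0z.
- by rewrite IH1 IH2 -big_split; apply: eq_bigr => i _; rewrite mulrzDr.
- by rewrite IH -sumrN; apply: eq_bigr => i _; rewrite mulrNz.
- by rewrite IH mulrz_suml; apply: eq_bigr => i _; rewrite mulrzA.
Qed.

(** The hypothesis is an explicit conjunction over [iota], so that [cbn] unfolds it to one integer
    equation per atom. *)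
Lemma zeval_eq (Q : zmodType) (env : seq Q) (e1 e2 : zexp) :
  foldr (fun i P => zcoef i e1 = zcoef i e2 /\ P) True (iota 0 (size env)) ->
  zeval env e1 = zeval env e2.
Proof.
move=> h; rewrite !zeval_sum; apply: eq_bigr => i _; congr (_ *~ _).
have: nat_of_ord i \in iota 0 (size env) by rewrite mem_iota /= ltn_ord.
elim: (iota _ _) h => //= k s IH [hk hs]; rewrite inE => /orP[/eqP->//|].
exact: IH.
Qed.

Ltac zatom x env :=
  lazymatch env with
  | nil => constr:(x :: nil)
  | ?y :: ?t =>
      match goal with
      | _ => let _ := match goal with _ => unify x y end in env
      | _ => let t' := zatom x t in constr:(y :: t')
      end
  end.
Ltac zatoms t env :=
  lazymatch t with
  | @GRing.add _ ?a ?b => let env' := zatoms a env in zatoms b env'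
  | @GRing.opp _ ?a => zatoms a env
  | @intmul _ ?a _ => zatoms a env
  | @GRing.zero _ => env
  | _ => zatom t env
  end.
Ltac zindex x env :=
  lazymatch env with
  | ?y :: ?t =>
      match goal with
      | _ => let _ := match goal with _ => unify x y end in constr:(0%N)
      | _ => let k := zindex x t in constr:(S k)
      end
  end.
Ltac zreify t env :=
  lazymatch t with
  | @GRing.add _ ?a ?b =>
      let a' := zreify a env in let b' := zreify b env in constr:(ZAdd a' b')
  | @GRing.opp _ ?a => let a' := zreify a env in constr:(ZOpp a')
  | @intmul _ ?a ?n => let a' := zreify a env in constr:(ZMul a' n)
  | @GRing.zero _ => constr:(ZZero)
  | _ => let k := zindex t env in constr:(ZVar k)
  end.
(* Reduces an equation between integer linear combinations of atoms, which are
   compared up to conversion, to the equations between their coefficients. *)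
Ltac zmod_coefs :=
  lazymatch goal with
  | |- @eq ?T ?l ?r =>
      let env0 := zatoms l (@nil T) in
      let env := zatoms r env0 in
      let l' := zreify l env in
      let r' := zreify r env in
      apply: (@zeval_eq _ env l' r');
      cbn [zcoef eqn foldr iota size]; repeat split
  end.

(** * Universal properties of sums of cyclic groups *)

Lemma additive_build (U V : zmodType) (f : U -> V) :
  {morph f : x y / x + y} -> exists g : {additive U -> V}, g =1 f.
Proof.
move=> fD.
have fB : zmod_morphism f.
  by move=> x y; apply: (addIr (f y)); rewrite -fD !subrK.
pose fM := GRing.isZmodMorphism.Build U V f fB.
by exists (HB.pack f fM : {additive U -> V}).
Qed.

Lemma zmod_iso_build (U V : zmodType) (f : {additive U -> V}) (g : V -> U) :
  cancel f g -> cancel g f -> zmod_iso U V.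
Proof. by move=> fK gK; exists f; exists g. Qed.

Lemma zmod_iso_trans (U V W : zmodType) :
  zmod_iso U V -> zmod_iso V W -> zmod_iso U W.
Proof. by move=> [f bf] [g bg]; exists (g \o f); apply: bij_comp. Qed.

Lemma Zp_lift (Q : zmodType) (n : nat) (w : Q) : (1 < n)%N -> w *~ n = 0 ->
  exists g : {additive 'Z_n -> Q}, g 1 = w.
Proof.
move=> n1 wn0.
have wmod k : w *+ (k %% n) = w *+ k.
  by rewrite {2}(divn_eq k n) mulrnDr mulnC mulrnA (wn0 : w *+ n = 0) mul0rn add0r.
have fD (x y : 'Z_n) : w *+ (x + y)%R = w *+ x + w *+ y.
  by rewrite -mulrnDr -[RHS]wmod /= [X in (_ %% X)%N]Zp_cast.
have [g gE] := additive_build (f := fun z : 'Z_n => w *+ z) fD.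
by exists g; rewrite gE.
Qed.

Lemma Zp_ind_add (n : nat) (P : 'Z_n -> Prop) :
  P 0 -> (forall x y, P x -> P y -> P (x + y)) -> P 1 -> forall z, P z.
Proof.
move=> P0 PD P1 z; rewrite -[z]natr_Zp; elim: (z : nat) => // k IH.
by rewrite mulrS; apply: PD.
Qed.

Lemma rV_lift (R Q : zmodType) n (h : 'I_n -> {additive R -> Q}) :
  exists g : {additive 'rV[R]_n -> Q}, forall r, g r = \sum_i h i (r 0 i).
Proof.
have fD : {morph (fun r : 'rV[R]_n => \sum_i h i (r 0 i)) : x y / x + y}.
  by move=> x y /=; rewrite -big_split; apply: eq_bigr => i _; rewrite mxE raddfD.
by have [g gE] := additive_build fD; exists g.
Qed.

Lemma rVZp_lift (Q : zmodType) (d n : nat) (e : 'I_n -> Q) :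
  (1 < d)%N -> (forall i, e i *~ d = 0) ->
  exists g : {additive 'rV['Z_d]_n -> Q}, forall i, g (delta_mx 0 i) = e i.
Proof.
move=> d1 e0; have [h hE] := choice (fun i => Zp_lift d1 (e0 i)).
have [g gE] := rV_lift h; exists g => i.
rewrite gE (bigD1 i) //= mxE !eqxx hE big1 ?addr0 // => j ji.
by rewrite mxE eqxx (negPf ji) raddf0.
Qed.

Lemma rVZp_ind_add (d n : nat) (P : 'rV['Z_d]_n -> Prop) :
  P 0 -> (forall x y, P x -> P y -> P (x + y)) ->
  (forall i, P (delta_mx 0 i)) -> forall r, P r.
Proof.
move=> P0 PD Pd r; rewrite (row_sum_delta r).
apply: (big_ind P) => // i _; rewrite -[r 0 i]natr_Zp scaler_nat.
by elim: (r 0 i : nat) => // k IH; rewrite mulrS; apply: PD.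
Qed.

Lemma pair_lift (U V Q : zmodType) (f : {additive U -> Q}) (g : {additive V -> Q}) :
  exists h : {additive (U * V)%type -> Q}, forall z, h z = f z.1 + g z.2.
Proof.
have hD : {morph (fun z : U * V => f z.1 + g z.2) : x y / x + y}.
  by move=> [x1 x2] [y1 y2] /=; rewrite !raddfD addrACA.
by have [h hE] := additive_build hD; exists h.
Qed.

Lemma pair_ind_add (U V : zmodType) (P : U * V -> Prop) :
  (forall x y, P x -> P y -> P (x + y)) ->
  (forall u, P (u, 0)) -> (forall v, P (0, v)) -> forall z, P z.
Proof.
move=> PD P1 P2 [u v].
have -> : (u, v) = (u, 0) + (0, v) by congr pair; rewrite ?addr0 ?add0r.
exact: PD.
Qed.

Lemma pair_mulrn (U V : zmodType) (z : U * V) n : z *+ n = (z.1 *+ n, z.2 *+ n).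
Proof. by elim: n => // n IH; rewrite !mulrS IH. Qed.

(** * Cokernels of integer matrices *)

Section Coker.
Variables (m n : nat) (A : 'M[int]_(m, n)).

Definition coker_pi (v : 'cV[int]_m) : int_coker A := (\pi_(int_coker A) v)%qT.

Lemma coker_piB : zmod_morphism coker_pi.
Proof. by move=> u v; rewrite /coker_pi !piE. Qed.

HB.instance Definition _ :=
  GRing.isZmodMorphism.Build 'cV[int]_m (int_coker A) coker_pi coker_piB.

Lemma coker_pi_surj (c : int_coker A) : exists v, c = coker_pi v.
Proof. by exists (repr c); rewrite /coker_pi reprK. Qed.

Lemma coker_pi_eq (u v : 'cV[int]_m) :
  coker_pi u = coker_pi v <-> exists w, u - v = A *m w.
Proof.
have -> : coker_pi u = coker_pi v <-> u - v \in int_im A.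
  by rewrite Quotient.idealrBE; split => /eqP.
by split => [/asboolP //|h]; apply/asboolP.
Qed.

Lemma coker_gen_rel (j : 'I_n) :
  \sum_i coker_pi (delta_mx i 0) *~ A i j = 0.
Proof.
rewrite -[RHS](raddf0 coker_pi).
transitivity (coker_pi (col j A)); last first.
  by apply/coker_pi_eq; exists (delta_mx j 0); rewrite subr0 colE.
rewrite [col j A]matrix_sum_delta raddf_sum; apply: eq_bigr => i _.
by rewrite big_ord1 mxE -raddfMz -scaler_int intz.
Qed.

(** The linear extension [F] of [Y] vanishes on the image of [A], so it may be evaluated on the
    chosen representative [repr]. *)
Lemma coker_lift (Q : zmodType) (Y : 'I_m -> Q) :
  (forall j, \sum_i Y i *~ A i j = 0) ->
  exists f : {additive int_coker A -> Q}, forall i, f (coker_pi (delta_mx i 0)) = Y i.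
Proof.
move=> Yrel; pose F (v : 'cV[int]_m) := \sum_i Y i *~ v i 0.
have FD u v : F (u + v) = F u + F v.
  by rewrite /F -big_split; apply: eq_bigr => i _; rewrite mxE mulrzDr.
have F0 w : F (A *m w) = 0.
  rewrite /F (eq_bigr (fun i => \sum_j Y i *~ A i j *~ w j 0)); last first.
    by move=> i _; rewrite mxE mulrz_sumr; apply: eq_bigr => j _; rewrite mulrzA.
  by rewrite exchange_big big1 // => j _; rewrite -mulrz_suml Yrel mul0rz.
have Fpi v : F (repr (coker_pi v)) = F v.
  have /coker_pi_eq[w hw] : coker_pi (repr (coker_pi v)) = coker_pi v.
    by rewrite [LHS]reprK.
  by rewrite -[repr _](subrK v) hw FD F0 add0r.
have fD : {morph (F \o repr : int_coker A -> Q) : c d / c + d}.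
  move=> c d; have [[u ->] [v ->]] := (coker_pi_surj c, coker_pi_surj d).
  by rewrite -raddfD /= !Fpi FD.
have [f fE] := additive_build fD; exists f => i.
rewrite fE /= Fpi /F (bigD1 i) //= big1 ?addr0 => [|j ji]; first by rewrite mxE !eqxx.
by rewrite mxE (negPf ji) mulr0z.
Qed.

Lemma coker_ext (Q : zmodType) (f g : {additive int_coker A -> Q}) :
  (forall i, f (coker_pi (delta_mx i 0)) = g (coker_pi (delta_mx i 0))) -> f =1 g.
Proof.
move=> fg c; have [v ->] := coker_pi_surj c.
rewrite [v]matrix_sum_delta !raddf_sum; apply: eq_bigr => i _.
by rewrite big_ord1 -[v i 0]intz scaler_int !raddfMz fg.
Qed.

End Coker.

Definition has_exponent (U : zmodType) :=
  exists2 N : nat, (0 < N)%N & forall x : U, x *+ N = 0.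

Lemma has_exponent_Zp (n : nat) : has_exponent 'Z_n.
Proof.
by exists (Zp_trunc n).+2 => // x; rewrite Zp_mulrn; apply: val_inj; rewrite /= modnMl.
Qed.

Lemma has_exponent_rV (U : zmodType) (n : nat) : has_exponent U -> has_exponent 'rV[U]_n.
Proof.
by move=> [N N0 UN]; exists N => // r; apply/rowP => i; rewrite mulmxnE mxE UN.
Qed.

Lemma has_exponent_pair (U V : zmodType) :
  has_exponent U -> has_exponent V -> has_exponent (U * V)%type.
Proof.
move=> [M M0 UM] [N N0 VN]; exists (M * N)%N; rewrite ?muln_gt0 ?M0 // => -[u v].
by rewrite pair_mulrn /= mulrnA UM mul0rn mulnC mulrnA VN mul0rn.
Qed.

(** [int] is torsion-free and a common exponent makes all of [H] torsion, so the torsion of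
    [H * int] is its first factor. *)
Lemma torsion_iso (C H : zmodType) (f : {additive C -> (H * int)%type}) :
  has_exponent H -> bijective f -> zmod_iso (torsion C) H.
Proof.
move=> [N N0 HN] [g fK gK].
have fst_D : {morph (fun t : torsion C => (f (torsion_val t)).1) : x y / x + y}.
  by move=> x y; rewrite -[torsion_val (x + y)]/(torsion_val x + torsion_val y) raddfD.
have [h hE] := additive_build fst_D.
have snd0 (t : torsion C) : (f (torsion_val t)).2 = 0.
  have /asboolP[k k0 tk] := torsion_valP t.
  have : (f (torsion_val t) *+ k).2 = 0 by rewrite -raddfMn tk raddf0.
  by move/eqP; rewrite pair_mulrn mulrn_eq0 (gtn_eqF k0) => /eqP.
have tors (x : H) : g (x, 0) \in @is_torsion C.
  apply/asboolP; exists N => //; apply: (can_inj fK).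
  by rewrite raddfMn gK raddf0 pair_mulrn /= HN mul0rn.
apply: (@zmod_iso_build _ _ h (fun x => Torsion (tors x))) => [t|x].
  apply: val_inj => /=; apply: (can_inj fK); rewrite gK hE.
  by rewrite [RHS]surjective_pairing snd0.
by rewrite hE /= gK.
Qed.

(** * The sandpile group of a cone *)

Lemma big_optionType (V : nmodType) (I : finType) (P : pred (option I)) (F : option I -> V) :
  \sum_(i | P i) F i = (if P None then F None else 0) + \sum_(i | P (Some i)) F (Some i).
Proof.
rewrite ![index_enum _]unlock [@Finite.enum in LHS]unlock /= big_cons big_map.
by case: ifP => _; rewrite ?add0r.
Qed.

Lemma laplacian_col_sum (G : sgraph) (Q : zmodType) (Y : G -> Q) (v : G) :
  \sum_i Y (enum_val i) *~ laplacian G i (enum_rank v) =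
  \sum_(w | edge v w) (Y v - Y w).
Proof.
transitivity (\sum_(w : G) Y w *~ laplacian G (enum_rank w) (enum_rank v)).
  rewrite (reindex (@enum_rank G)) /=; last exact/onW_bij/enum_rank_bij.
  by apply: eq_bigr => w _; rewrite enum_rankK.
transitivity (\sum_(w : G) (Y w *~ (w == v)%:R *~ (degree w)%:R - Y w *~ (edge w v)%:R)).
  apply: eq_bigr => w _; rewrite !mxE !enum_rankK (inj_eq enum_rank_inj) mulrzBr.
  by case: (w == v); rewrite ?mulr0z ?mul0rz ?mulr1z.
rewrite big_split (bigD1 v) //= eqxx mulr1z big1 ?addr0; last first.
  by move=> w /negPf->; rewrite mulr0z mul0rz.
rewrite sumrN [\sum_(w | edge v w) _]big_split /= sumrN; congr (_ - _).
  rewrite sumr_const natz; congr (_ *+ _); apply: eq_card => w.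
  by rewrite !inE.
rewrite [RHS]big_mkcond; apply: eq_bigr => w _; rewrite edge_sym.
by case: (edge v w); rewrite ?mulr0z ?mulr1z.
Qed.

Section ConeSandpile.
Variable G : sgraph.

(* The relations defining the cokernel of the reduced Laplacian of the cone,
   the apex being sent to 0. *)
Definition cone_harmonic (Q : zmodType) (X : G -> Q) :=
  forall v, X v + \sum_(w | edge v w) (X v - X w) = 0.

Let C := int_coker (laplacian (Cone G)).

Definition cone_gen (x : Cone G) : C := coker_pi _ (delta_mx (enum_rank x) 0).

Lemma cone_gen_sum (v : Cone G) :
  \sum_(w | edge v w) (cone_gen v - cone_gen w) = 0.
Proof.
rewrite -laplacian_col_sum -[RHS](coker_gen_rel (laplacian (Cone G)) (enum_rank v)).
by apply: eq_bigr => i _; rewrite /cone_gen enum_valK.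
Qed.

Lemma cone_gen_harmonic : cone_harmonic (fun v => cone_gen (Some v) - cone_gen None).
Proof.
move=> v; rewrite -[RHS](cone_gen_sum (Some v)) big_optionType /=; congr (_ + _).
by apply: eq_bigr => w _; rewrite opprB addrA subrK.
Qed.

(** The relation at the apex follows from the others: in their sum the differences along the edges
    of [G] cancel, which leaves the sum of the [X v] equal to 0. *)
Lemma cone_coker_lift (Q : zmodType) (X : G -> Q) (b : Q) : cone_harmonic X ->
  exists f : {additive C -> Q},
    f (cone_gen None) = b /\ forall v, f (cone_gen (Some v)) = X v + b.
Proof.
move=> hX; pose Y (x : Cone G) : Q := if x is Some v then X v + b else b.
have Yrel (x : Cone G) : \sum_(y | edge x y) (Y x - Y y) = 0.
  case: x => [v|]; rewrite big_optionType /=.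
    by rewrite addrK -[RHS](hX v); congr (_ + _); apply: eq_bigr => w _;
    rewrite opprD addrACA subrr addr0.
  rewrite add0r; under eq_bigr => v _ do rewrite opprD addrCA subrr addr0.
  rewrite sumrN; apply/eqP; rewrite oppr_eq0; apply/eqP.
  have S0 : \sum_v \sum_(w | edge v w) (X v - X w) = 0.
    rewrite (eq_bigr (fun v => \sum_(w | edge v w) X v - \sum_(w | edge v w) X w));
      last by move=> v _; rewrite sumrB.
    rewrite sumrB; apply/eqP; rewrite subr_eq0; apply/eqP.
    rewrite [RHS](exchange_big_dep xpredT) //=.
    by apply: eq_bigr => v _; apply: eq_bigl => w; rewrite edge_sym.
  have : \sum_v (X v + \sum_(w | edge v w) (X v - X w)) = 0 by rewrite big1.
  by rewrite big_split /= S0 addr0.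
have [|f fE] := @coker_lift _ _ (laplacian (Cone G)) Q (fun i => Y (enum_val i)).
  by move=> j; rewrite -(enum_valK j) laplacian_col_sum.
by exists f; split => [|v]; rewrite fE enum_rankK.
Qed.

Lemma cone_coker_ext (Q : zmodType) (f g : {additive C -> Q}) :
  (forall x, f (cone_gen x) = g (cone_gen x)) -> f =1 g.
Proof.
by move=> fg; apply: coker_ext => i; have := fg (enum_val i); rewrite /cone_gen enum_valK.
Qed.

(** The cokernel of the full Laplacian is [H * int]: the apex generates the factor [int], and
    subtracting it from every other vertex gives the universal solution with the apex at 0. Passing
    to torsion leaves [H]. *)
Lemma sandpile_cone_iso (H : zmodType) (X : G -> H) :
  has_exponent H -> cone_harmonic X ->
  (forall (Q : zmodType) (X' : G -> Q), cone_harmonic X' ->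
     exists g : {additive H -> Q}, forall v, g (X v) = X' v) ->
  (forall g : {additive H -> H}, (forall v, g (X v) = X v) -> g =1 id) ->
  zmod_iso (sandpile (Cone G)) H.
Proof.
move=> expH hX Xlift Xext.
have hX0 : cone_harmonic (fun v => (X v, 0 : int)).
  move=> v; have -> : \sum_(w | edge v w) ((X v, 0 : int) - (X w, 0)) =
                      (\sum_(w | edge v w) (X v - X w), 0).
    by elim/big_rec2: _ => // w y1 y2 _ ->; congr pair.
  by rewrite -[LHS]/(_, _) hX.
have [f [fN fS]] := cone_coker_lift (0, 1 : int) hX0.
have [g0 g0E] := Xlift _ _ cone_gen_harmonic.
have [z zE] := additive_build (f := fun n : int => cone_gen None *~ n) (fun m n => mulrzDr _ m n).
have [g gE] := pair_lift g0 z.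
apply: (torsion_iso (f := f) expH); exists g => c.
  apply: (cone_coker_ext (f := g \o f) (g := idfun)) => -[v|] /=.
    by rewrite fS gE zE /= add0r addr0 g0E mulr1z subrK.
  by rewrite fN gE zE /= raddf0 add0r mulr1z.
have f1D : {morph (fun h => (f (g0 h)).1) : x y / x + y} by move=> x y; rewrite !raddfD.
have [f1 f1E] := additive_build f1D.
have f1_id : f1 =1 id.
  apply: Xext => v; rewrite f1E g0E raddfB fN fS /=.
  by rewrite addr0 subr0.
have f2 h : (f (g0 h)).2 = 0.
  have [N N0 HN] := expH.
  have : (f (g0 h) *+ N).2 = 0 by rewrite -!raddfMn HN !raddf0.
  by move/eqP; rewrite pair_mulrn mulrn_eq0 (gtn_eqF N0) => /eqP.
have p1 (n : int) : ((0 : H, 1 : int)) *~ n = (0, n).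
  have pn (k : nat) : ((0 : H, 1 : int)) *+ k = (0, k%:Z).
    by rewrite pair_mulrn /= mul0rn natz.
  case: n => k; first exact: pn.
  by rewrite NegzE mulrNz [_ *~ _]pn; congr pair; rewrite oppr0.
case: c => h n; rewrite gE zE /= raddfD raddfMz fN p1 [f (g0 h)]surjective_pairing f2.
by rewrite -f1E f1_id; congr pair; rewrite /= ?addr0 ?add0r.
Qed.

End ConeSandpile.

(** * The presentation by leaves *)

(* [evenfib k] is the Fibonacci number F_(2k). *)
Fixpoint evenfib (k : nat) : int :=
  match k with
  | 0 => 0
  | 1 => 1
  | (k'.+1 as k1).+1 => 3 * evenfib k1 - evenfib k'
  end.

Lemma evenfib_rec k : evenfib k.+2 = 3 * evenfib k.+1 - evenfib k.
Proof. by []. Qed.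

Section PathSequence.
Variables (Q : zmodType) (q0 q1 : Q).

Fixpoint pathseq (k : nat) : Q :=
  match k with
  | 0 => q0
  | 1 => q1
  | (k'.+1 as k1).+1 => pathseq k1 *~ 3 - pathseq k'
  end.

Lemma pathseq0 : pathseq 0 = q0. Proof. by []. Qed.

Lemma pathseq1 : pathseq 1 = q1. Proof. by []. Qed.

Lemma pathseq_rec k : pathseq k.+2 = pathseq k.+1 *~ 3 - pathseq k.
Proof. by []. Qed.

Lemma pathseq_evenfib k : pathseq k.+1 = q1 *~ evenfib k.+1 - q0 *~ evenfib k.
Proof.
suff [] : pathseq k.+1 = q1 *~ evenfib k.+1 - q0 *~ evenfib k /\
          pathseq k.+2 = q1 *~ evenfib k.+2 - q0 *~ evenfib k.+1 by [].
elim: k => [|k [IH1 IH2]].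
  by split; rewrite /=; zmod_coefs.
split=> //; rewrite pathseq_rec IH1 IH2 (evenfib_rec k.+1).
by zmod_coefs; rewrite !evenfib_rec; ring.
Qed.

(** The leaves at pi_1 contribute to the relation there exactly what an edge to the virtual vertex
    pi_0 would; every path vertex then has the same backward term. *)
Lemma pathseq_backward (s : int) k :
  (if k == 0%N then pathseq k.+1 *~ s - (q0 + q1 *~ (s - 1)) else 0) =
  pathseq k.+1 - pathseq k
  - (if (0 < k)%N then pathseq k.+1 - pathseq k.-1.+1 else 0).
Proof.
case: k => [|k]; last by rewrite subrr.
by rewrite eqxx ltnn pathseq0 pathseq1; zmod_coefs; ring.
Qed.

End PathSequence.

Arguments evenfib : simpl never.
Arguments pathseq : simpl never.

(* The relations between the leaves [x] at pi_1, the leaves [y] at pi_p, the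
   image [q1] of pi_1 and a virtual predecessor [q0] of pi_1, when the
   recurrence pi_(k+1) = 3 pi_k - pi_(k-1) along the path is used to write
   pi_p = q1 F - q0 E and its virtual successor as q1 (3F - E) - q0 F. *)
Definition leaf_pres (E F : int) (s1 s2 : nat) (Q : zmodType)
    (x : 'I_s1 -> Q) (y : 'I_s2 -> Q) (q0 q1 : Q) :=
  [/\ forall i, x i *~ 2 = q1,
      \sum_i x i = q0 + q1 *~ (s1%:Z - 1),
      forall j, y j *~ 2 = q1 *~ F - q0 *~ E
    & \sum_j y j =
        q1 *~ (3 * F - E) - q0 *~ F + (q1 *~ F - q0 *~ E) *~ (s2%:Z - 1)].

Lemma big_ord_adjacent (V : nmodType) n (i : 'I_n.+1) (g : nat -> V) :
  \sum_(j < n.+1 | (i.+1 == j) || (j.+1 == i)) g j =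
  (if (i < n)%N then g i.+1 else 0) + (if (0 < i)%N then g i.-1 else 0).
Proof.
rewrite big_mkcond (eq_bigr (fun j : 'I_n.+1 => (if i.+1 == j then g j else 0)
  + (if j.+1 == i then g j else 0))); last first.
  move=> j _; case: eqP => [<-|_] /=; last by case: eqP; rewrite add0r.
  by rewrite ifN ?addr0 // gtn_eqF.
rewrite big_split -!big_mkcond /=; congr (_ + _).
  case: ifP => hi.
    by rewrite (big_pred1 (Ordinal (hi : (i.+1 < n.+1)%N))).
  by rewrite big_pred0 // => j; apply/negP => /eqP ij; have := ltn_ord j; lia.
case: ifP => hi.
  have hi1 : (i.-1 < n.+1)%N by have := ltn_ord i; lia.
  by rewrite (big_pred1 (Ordinal hi1)) // => j; apply/eqP/eqP => [ij|->];
    [apply: val_inj | move: hi] => /=; lia.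
by rewrite big_pred0 // => j; lia.
Qed.

Lemma sum_ord_subl (V : zmodType) n (c : V) (g : 'I_n -> V) :
  \sum_i (c - g i) = c *~ n - \sum_i g i.
Proof. by rewrite sumrB sumr_const card_ord. Qed.

Section Bicoconut.
Variables (n s1 s2 : nat) (Q : zmodType).

Lemma bicoconut_harmonicP (X : bicoconut n.+1 s1 s2 -> Q) (P : nat -> Q)
    (sx := \sum_i X (inr (inl i))) (sy := \sum_i X (inr (inr i))) :
  (forall i : 'I_n.+1, X (inl i) = P i) ->
  cone_harmonic X <->
  [/\ forall i, X (inr (inl i)) *~ 2 = P 0%N,
      forall i, X (inr (inr i)) *~ 2 = P n
    & forall i, (i <= n)%N ->
        P i + ((if (i < n)%N then P i - P i.+1 else 0)
             + (if (0 < i)%N then P i - P i.-1 else 0))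
        + ((if i == 0%N then P i *~ s1 - sx else 0)
           + (if i == n then P i *~ s2 - sy else 0)) = 0].
Proof.
move=> XP.
have leafE (r t : Q) : (r + (r - t) = 0) <-> (r *~ 2 = t).
  rewrite addrA -[r + r]/(r *~ 2); split => [/eqP|->]; last exact: subrr.
  by rewrite subr_eq0 => /eqP.
have hx i : let v : bicoconut n.+1 s1 s2 := inr (inl i) in
    \sum_(w | edge v w) (X v - X w) = X v - P 0%N.
  move=> v; rewrite (big_sumType _ (edge v)) /= addrC big_sumType /= !big_pred0_eq !add0r.
  by rewrite (big_pred1 ord0) ?XP.
have hy i : let v : bicoconut n.+1 s1 s2 := inr (inr i) in
    \sum_(w | edge v w) (X v - X w) = X v - P n.
  move=> v; rewrite (big_sumType _ (edge v)) /= addrC big_sumType /= !big_pred0_eq !add0r.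
  by rewrite (big_pred1 ord_max) ?XP // => j; rewrite eqSS.
have hp (i : 'I_n.+1) : let v : bicoconut n.+1 s1 s2 := inl i in
    \sum_(w | edge v w) (X v - X w) =
    ((if (i < n)%N then P i - P i.+1 else 0)
             + (if (0 < i)%N then P i - P i.-1 else 0))
        + ((if i == 0%N :> nat then P i *~ s1 - sx else 0)
           + (if i == n :> nat then P i *~ s2 - sy else 0)).
  move=> v; rewrite (big_sumType _ (edge v)) big_sumType /=; congr (_ + (_ + _)).
  - rewrite -(big_ord_adjacent i (fun k => P i - P k)).
    by apply: eq_bigr => j _; rewrite !XP.
  - by case: eqP => _; rewrite ?big_pred0_eq // sum_ord_subl XP.
  - by rewrite eqSS; case: eqP => _; rewrite ?big_pred0_eq // sum_ord_subl XP.
split=> [hX|[h1 h2 h3] [i|[i|i]]].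
- split=> [i|i|i ilen].
  + by apply/leafE; rewrite -hx; apply: hX.
  + by apply/leafE; rewrite -hy; apply: hX.
  + have := hX (inl (Ordinal (ilen : (i < n.+1)%N))).
    by rewrite hp XP addrA.
- by rewrite hp XP addrA h3 // -ltnS.
- by rewrite hx; apply/leafE.
- by rewrite hy; apply/leafE.
Qed.

Definition leaf_extend (x : 'I_s1 -> Q) (y : 'I_s2 -> Q) (q0 q1 : Q)
    (v : bicoconut n.+1 s1 s2) : Q :=
  match v with
  | inl i => pathseq q0 q1 i.+1
  | inr (inl i) => x i
  | inr (inr i) => y i
  end.

Lemma leaf_extend_harmonic x y q0 q1 :
  leaf_pres (evenfib n) (evenfib n.+1) x y q0 q1 ->
  cone_harmonic (leaf_extend x y q0 q1).
Proof.
move=> [x2 xs y2 ys].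
apply/(bicoconut_harmonicP (P := fun k => pathseq q0 q1 k.+1)) => //.
split=> [i|i|i ilen] //=; first by rewrite y2 -pathseq_evenfib.
have {}ys : \sum_j y j = pathseq q0 q1 n.+2 + pathseq q0 q1 n.+1 *~ (s2%:Z - 1).
  by rewrite ys (pathseq_evenfib _ _ n.+1) pathseq_evenfib.
rewrite xs ys pathseq_backward; case: (ltnP i n) => [iltn|nlei].
  by rewrite (ltn_eqF iltn) pathseq_rec; zmod_coefs; ring.
have -> : i = n by lia.
by rewrite eqxx (pathseq_rec _ _ n); zmod_coefs; ring.
Qed.

Lemma harmonic_leaf_pres (X : bicoconut n.+1 s1 s2 -> Q) :
  cone_harmonic X -> exists q0 q1,
    leaf_pres (evenfib n) (evenfib n.+1)
      (fun i => X (inr (inl i))) (fun i => X (inr (inr i))) q0 q1 /\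
    X =1 leaf_extend (fun i => X (inr (inl i))) (fun i => X (inr (inr i))) q0 q1.
Proof.
move=> hX; pose P k := X (inl (inord k)).
have XP (i : 'I_n.+1) : X (inl i) = P i by rewrite /P inord_val.
have /(bicoconut_harmonicP XP)[x2 y2 hP] := hX.
(* This [q0] makes the leaf sum relation at pi_1 true by definition; the harmonic relation at pi_1
   then becomes the recurrence that yields pi_2. *)
pose q1 := P 0%N; pose q0 := \sum_i X (inr (inl i)) - q1 *~ (s1%:Z - 1).
have PE k : (k <= n)%N -> P k = pathseq q0 q1 k.+1.
  suff : ((k <= n)%N -> P k = pathseq q0 q1 k.+1) /\
         ((k.+1 <= n)%N -> P k.+1 = pathseq q0 q1 k.+2) by case.
  elim: k => [|k [IH1 IH2]]; split => // hk.
    have := hP 0%N (leq0n n); rewrite hk ltnn eqxx (ltn_eqF hk) => h0.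
    apply/eqP; rewrite eq_sym -subr_eq0 -h0 pathseq_rec pathseq0 pathseq1 /q0 /q1; apply/eqP.
    by zmod_coefs; ring.
  have hk1 := ltnW hk; have hk2 := ltnW hk1.
  have := hP k.+1 hk1; rewrite hk (ltn_eqF hk) ltn0Sn eqn0Ngt ltn0Sn [k.+1.-1]/=
    IH2 // IH1 //= => h0.
  apply/eqP; rewrite eq_sym -subr_eq0 -h0 (pathseq_rec _ _ k.+1); apply/eqP.
  by zmod_coefs; ring.
exists q0, q1; split; last first.
  by move=> [i|[i|i]] //=; rewrite XP PE // -ltnS.
split=> //; first by rewrite subrK.
  by move=> j; rewrite y2 PE // pathseq_evenfib.
rewrite -pathseq_evenfib -(pathseq_evenfib _ _ n.+1).
have sxE : \sum_i X (inr (inl i)) = q0 + q1 *~ (s1%:Z - 1) by rewrite subrK.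
(* At the last vertex, the harmonic relation written with the virtual successor computes the sum of
   the leaves there. *)
have := hP n (leqnn n); rewrite ltnn eqxx sxE !PE ?leq_pred // pathseq_backward => h0.
apply/eqP; rewrite -subr_eq0 -[X in _ == X]oppr0 -[X in _ == - X]h0 pathseq_rec; apply/eqP.
by zmod_coefs; ring.
Qed.

End Bicoconut.

(** Maps are prescribed on leaves only: [q0] and [q1] are combinations of the [x i] as soon as
    [s1 > 0]. Uniqueness concerns endomorphisms, which is what identifying a composite with the
    identity takes. *)
Definition universal_leaf_pres (E F : int) (s1 s2 : nat) (H : zmodType) :=
  exists (x : 'I_s1 -> H) (y : 'I_s2 -> H) (q0 q1 : H),
  [/\ leaf_pres E F x y q0 q1,
      forall (Q : zmodType) (x' : 'I_s1 -> Q) (y' : 'I_s2 -> Q) (q0' q1' : Q),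
        leaf_pres E F x' y' q0' q1' ->
        exists g : {additive H -> Q}, (forall i, g (x i) = x' i) /\ (forall j, g (y j) = y' j)
    & forall g : {additive H -> H},
        (forall i, g (x i) = x i) -> (forall j, g (y j) = y j) -> g =1 id].

Lemma raddf_pathseq (U V : zmodType) (g : {additive U -> V}) q0 q1 k :
  g (pathseq q0 q1 k) = pathseq (g q0) (g q1) k.
Proof.
suff [] : g (pathseq q0 q1 k) = pathseq (g q0) (g q1) k /\
          g (pathseq q0 q1 k.+1) = pathseq (g q0) (g q1) k.+1 by [].
elim: k => // k [IH1 IH2]; split => //.
by rewrite !pathseq_rec raddfB raddfMz IH1 IH2.
Qed.

Lemma leaf_pres_q0 E F s1 s2 (Q : zmodType) (x : 'I_s1 -> Q) (y : 'I_s2 -> Q) q0 q1 :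
  leaf_pres E F x y q0 q1 -> q0 = \sum_i x i - q1 *~ (s1%:Z - 1).
Proof. by case=> _ -> _ _; rewrite addrK. Qed.

Lemma sandpile_bicoconut_iso n s1 s2 (H : zmodType) :
  (0 < s1)%N -> has_exponent H ->
  universal_leaf_pres (evenfib n) (evenfib n.+1) s1 s2 H ->
  zmod_iso (sandpile (Cone (bicoconut n.+1 s1 s2))) H.
Proof.
move=> s1_gt0 expH [x [y [q0 [q1 [Hpres Hlift Hext]]]]].
have i0 := Ordinal s1_gt0.
apply: (sandpile_cone_iso (X := leaf_extend x y q0 q1) expH (leaf_extend_harmonic Hpres)).
  move=> Q X' /harmonic_leaf_pres[q0' [q1' [Qpres X'E]]].
  have [g [gx gy]] := Hlift _ _ _ _ _ Qpres.
  have gq1 : g q1 = q1'.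
    by case: Hpres Qpres => + _ _ _ [+ _ _ _] => /(_ i0)<- /(_ i0)<-; rewrite raddfMz gx.
  have gq0 : g q0 = q0'.
    rewrite (leaf_pres_q0 Hpres) (leaf_pres_q0 Qpres) raddfB raddfMz gq1 raddf_sum.
    by congr (_ - _); apply: eq_bigr => i _.
  exists g => -[i|[i|i]]; rewrite X'E //=.
  by rewrite raddf_pathseq gq0 gq1.
by move=> g gX; apply: Hext => i; [apply: (gX (inr (inl i))) | apply: (gX (inr (inr i)))].
Qed.

(** One step of a linear certificate: the hypothesis [l = r] is subtracted [c] times from the goal.
    In a chain of such steps the multipliers are chosen so that the last equation holds identically
    in the atoms. *)
Lemma eq_lin (Q : zmodType) (l r : Q) (c : int) (L R : Q) :
  l = r -> L - l *~ c = R - r *~ c -> L = R.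
Proof. by move=> -> /addIr. Qed.

(** The path is read backwards, with pi_p and its virtual successor in the roles of pi_1 and pi_0.
    By the Cassini identity this change of coordinates is an involution. *)
Lemma leaf_pres_sym E F s1 s2 (Q : zmodType) (x : 'I_s1 -> Q) (y : 'I_s2 -> Q) q0 q1 :
  F ^+ 2 - 3 * F * E + E ^+ 2 = 1 ->
  leaf_pres E F x y q0 q1 ->
  leaf_pres E F y x (q1 *~ (3 * F - E) - q0 *~ F) (q1 *~ F - q0 *~ E).
Proof.
move=> cassini [x2 xs y2 ys].
have q1E : q1 = (q1 *~ F - q0 *~ E) *~ F - (q1 *~ (3 * F - E) - q0 *~ F) *~ E.
  zmod_coefs; last by ring.
  by rewrite -[LHS]cassini; ring.
split=> //; first by move=> i; rewrite x2.
rewrite -q1E xs; congr (_ + _).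
zmod_coefs; last by ring.
by rewrite -[LHS]cassini; ring.
Qed.

Lemma universal_leaf_pres_sym E F s1 s2 (H : zmodType) :
  F ^+ 2 - 3 * F * E + E ^+ 2 = 1 ->
  universal_leaf_pres E F s1 s2 H -> universal_leaf_pres E F s2 s1 H.
Proof.
move=> cassini [x [y [q0 [q1 [Hpres Hlift Hext]]]]].
exists y, x; eexists; eexists; split; first exact: leaf_pres_sym Hpres.
  move=> Q x' y' q0' q1' /(leaf_pres_sym cassini) /Hlift[g [gx gy]].
  by exists g.
by move=> g gy gx; apply: Hext.
Qed.

(** * Decomposition into cyclic groups *)

Definition fcons (T : Type) n (a : T) (f : 'I_n -> T) (i : 'I_n.+1) : T :=
  oapp f a (unlift ord0 i).

Lemma fcons0 (T : Type) n (a : T) (f : 'I_n -> T) : fcons a f ord0 = a.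
Proof. by rewrite /fcons unlift_none. Qed.

Lemma fconsS (T : Type) n (a : T) (f : 'I_n -> T) i : fcons a f (lift ord0 i) = f i.
Proof. by rewrite /fcons liftK. Qed.

Lemma sum_fcons (V : nmodType) n (a : V) (f : 'I_n -> V) :
  \sum_i fcons a f i = a + \sum_i f i.
Proof. by rewrite big_ord_recl fcons0; congr (_ + _); apply: eq_bigr => i _; rewrite fconsS. Qed.

Lemma ord_ind0 n (P : 'I_n.+1 -> Prop) :
  P ord0 -> (forall i, P (lift ord0 i)) -> forall i, P i.
Proof. by move=> P0 PS i; case: (unliftP ord0 i) => [j|] ->. Qed.

Lemma sum_ord_addl (V : zmodType) n (c : V) (g : 'I_n -> V) :
  \sum_i (c + g i) = c *~ n + \sum_i g i.
Proof. by rewrite big_split sumr_const card_ord. Qed.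

Lemma sum_ord_subr (V : zmodType) n (c : V) (g : 'I_n -> V) :
  \sum_i (g i - c) = \sum_i g i - c *~ n.
Proof. by rewrite sumrB sumr_const card_ord. Qed.

Lemma sum_mulrz_const (V : zmodType) n (g : 'I_n -> V) (k : int) (c : V) :
  (forall i, g i *~ k = c) -> (\sum_i g i) *~ k = c *~ n.
Proof.
by move=> gk; rewrite mulrz_suml (eq_bigr (fun=> c)) // sumr_const card_ord.
Qed.

Lemma sum_mulrz0 (V : zmodType) n (g : 'I_n -> V) (k : int) :
  (forall i, g i *~ k = 0) -> (\sum_i g i) *~ k = 0.
Proof. by move/sum_mulrz_const->; rewrite mul0rz. Qed.

Section LeafPres.
Variables (E F : int) (s1 s2 : nat) (Q : zmodType).
Variables (x : 'I_s1 -> Q) (y : 'I_s2 -> Q) (q0 q1 : Q).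
Hypothesis Qpres : leaf_pres E F x y q0 q1.

(** Doubling the leaf sum replaces each leaf by pi_1, so that only [q0] and [q1] remain. *)
Lemma leaf_pres_double1 : q0 *~ 2 = q1 *~ (2 - s1%:Z).
Proof.
have [x2 xs _ _] := Qpres; have := sum_mulrz_const x2; rewrite xs => h.
by apply: (eq_lin (c := 1) h); zmod_coefs; ring.
Qed.

Lemma leaf_pres_double2 :
  (q1 *~ (3 * F - E) - q0 *~ F) *~ 2 = (q1 *~ F - q0 *~ E) *~ (2 - s2%:Z).
Proof.
have [_ _ y2 ys] := Qpres; have := sum_mulrz_const y2; rewrite ys => h.
by apply: (eq_lin (c := 1) h); zmod_coefs; ring.
Qed.

End LeafPres.

(* [H] is the direct sum of copies of Z_2 generated by the [t i] and [r j], of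
   Z_a generated by [w] and of Z_d generated by [z]. *)
Definition leaf_basis (a d m1 m2 : nat) (H : zmodType)
    (t : 'I_m1 -> H) (r : 'I_m2 -> H) (w z : H) :=
  [/\ (forall i, t i *~ 2 = 0) /\ (forall j, r j *~ 2 = 0),
      w *~ a = 0,
      z *~ d = 0,
      forall (Q : zmodType) (t' : 'I_m1 -> Q) (r' : 'I_m2 -> Q) (w' z' : Q),
        (forall i, t' i *~ 2 = 0) -> (forall j, r' j *~ 2 = 0) ->
        w' *~ a = 0 -> z' *~ d = 0 ->
        exists g : {additive H -> Q},
          [/\ forall i, g (t i) = t' i, forall j, g (r j) = r' j, g w = w' & g z = z']
    & forall g : {additive H -> H},
        (forall i, g (t i) = t i) -> (forall j, g (r j) = r j) ->
        g w = w -> g z = z -> g =1 id].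

(** The determinant of the two relations [leaf_pres_double1] and [leaf_pres_double2] in the unknowns
    [q0] and [q1]. *)
Definition leaf_order (E F : int) (s1 s2 : nat) : int :=
  4 * (3 * F - E) + 2 * (s1%:Z + s2%:Z - 4) * F + (s1%:Z - 2) * (s2%:Z - 2) * E.

(** For E even, pi_p involves [q0] only through [q0 *~ 2], a multiple of [q1]. Hence pi_p is twice a
    multiple of the first leaf [w] at pi_1, and every leaf is a multiple of [w] up to an element
    killed by 2. *)
Lemma universal_even_E (E F e f : int) (a m1 m2 : nat) (H : zmodType)
    (t : 'I_m1 -> H) (r : 'I_m2 -> H) (w z : H) :
  E = e * 2 -> F = f * 2 + 1 ->
  a%:Z = leaf_order E F m1.+1 m2.+1 ->
  leaf_basis a 1 t r w z -> universal_leaf_pres E F m1.+1 m2.+1 H.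
Proof.
move=> Ee Ff aE [[t2 r2] wa z0 Hlift Hext].
(* [w *~ c2] is a half of pi_p and [a2] is half of [a]. The sum relation dictates the first [y];
   there F odd turns [T *~ F] into [T]. *)
pose c2 : int := F + (m1%:Z - 1) * e.
pose a2 : int := 2 * (3 * F - E) + (m1%:Z - 1) * F + (m2%:Z - 1) * c2.
pose T := \sum_i t i; pose R := \sum_j r j.
have T2 : T *~ 2 = 0 by apply: sum_mulrz0.
have R2 : R *~ 2 = 0 by apply: sum_mulrz0.
exists (fcons w (fun i => w + t i)).
exists (fcons (w *~ c2 + w *~ a2 + T + R) (fun j => w *~ c2 + r j)).
exists (w *~ (1 - m1%:Z) + T), (w *~ 2); split.
- split.
  + apply: ord_ind0 => [|i]; rewrite ?fcons0 ?fconsS //.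
    by apply: (eq_lin (c := 1) (t2 i)); zmod_coefs; ring.
  + by rewrite sum_fcons sum_ord_addl -/T; zmod_coefs; ring.
  + apply: ord_ind0 => [|j]; rewrite ?fcons0 ?fconsS.
      apply: (eq_lin (c := 1) wa); apply: (eq_lin (c := 1 + e) T2).
      apply: (eq_lin (c := 1) R2); rewrite aE /leaf_order /a2 /c2 Ee.
      by zmod_coefs; ring.
    apply: (eq_lin (c := 1) (r2 j)); apply: (eq_lin (c := e) T2).
    by rewrite /c2 Ee; zmod_coefs; ring.
  + rewrite sum_fcons sum_ord_addl -/R.
    apply: (eq_lin (c := 1) R2); apply: (eq_lin (c := f + 1 + e * m2%:Z) T2).
    by rewrite /a2 /c2 Ee Ff; zmod_coefs; ring.
- move=> Q x' y' q0' q1' Qpres; have [x2 xs y2 ys] := Qpres.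
  have Q0 := leaf_pres_double1 Qpres; have D2 := leaf_pres_double2 Qpres.
  move: x2 xs y2 ys Q0 D2; rewrite !big_ord_recl => x2 xs y2 ys Q0 D2.
  have q1E := x2 ord0; set u := x' ord0 in xs q1E *; subst q1'.
  have ua : u *~ a = 0.
    (* Elimination of [q0] between the doubled sums; E even makes the multiplier of [Q0] an
       integer. *)
    rewrite aE; apply: (eq_lin (c := 1) D2).
    apply: (eq_lin (c := F + e * (m2%:Z - 1)) Q0).
    by rewrite /leaf_order Ee; zmod_coefs; ring.
  have [||g [gt gr gw _]] := Hlift Q (fun i => x' (lift ord0 i) - u)
      (fun j => y' (lift ord0 j) - u *~ c2) u 0 _ _ ua (mul0rz _ _).
  + by move=> i; apply: (eq_lin (c := 1) (x2 (lift ord0 i))); zmod_coefs; ring.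
  + move=> j; apply: (eq_lin (c := 1) (y2 (lift ord0 j))).
    by apply: (eq_lin (c := - e) Q0); rewrite /c2 Ee; zmod_coefs; ring.
  exists g; split; apply: ord_ind0 => [|i]; rewrite ?fcons0 ?fconsS //.
  + by rewrite raddfD gw gt addrC subrK.
  + rewrite !raddfD !raddfMz gw !raddf_sum (eq_bigr _ (fun i _ => gt i)).
    rewrite (eq_bigr _ (fun i _ => gr i)) !sum_ord_subr.
    apply: (eq_lin (c := 1) xs); apply: (eq_lin (c := 1) ys).
    apply: (eq_lin (c := -1) (y2 ord0)); apply: (eq_lin (c := 1) ua).
    apply: (eq_lin (c := - f - e * (m2%:Z - 1)) Q0).
    by rewrite aE /leaf_order /a2 /c2 Ee Ff; zmod_coefs; ring.
  + by rewrite raddfD raddfMz gw gr addrC subrK.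
- move=> g gx gy.
  have gw : g w = w by have := gx ord0; rewrite fcons0.
  apply: Hext => // [i|j|].
  + by have := gx (lift ord0 i); rewrite fconsS raddfD gw => /addrI.
  + by have := gy (lift ord0 j); rewrite fconsS raddfD raddfMz gw => /addrI.
  (* Here [d = 1], and [z *~ 1 = 0] is convertible to [z = 0]. *)
  + by have -> : z = 0 by []; rewrite raddf0.
Qed.

(** For odd [s1] the coefficients 2 and [s1 - 2] of [leaf_pres_double1] are coprime, so [q0] and
    [q1] are multiples of a single element, which Bezout gives as [q0 + q1 *~ k]. *)
Lemma leaf_pres_root (E F k : int) (s1 s2 : nat) (Q : zmodType)
    (x : 'I_s1 -> Q) (y : 'I_s2 -> Q) (q0 q1 : Q) :
  s1%:Z = k * 2 + 1 -> leaf_pres E F x y q0 q1 ->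
  exists u, q1 = u *~ 2 /\ q0 = u *~ (2 - s1%:Z).
Proof.
move=> s1k /leaf_pres_double1 Q0.
have u2 : (q0 + q1 *~ k) *~ 2 = q1.
  by apply: (eq_lin (c := 1) Q0); rewrite s1k; zmod_coefs; ring.
exists (q0 + q1 *~ k); split => //.
by apply: (eq_lin (c := k) u2); rewrite s1k; zmod_coefs; ring.
Qed.

(** With [u] from [leaf_pres_root], pi_p is [u *~ c] with [c] odd. It is also the double of a leaf,
    so [u] is itself a double [w *~ 2], and [w] has order [2 * a]. *)
Lemma universal_odd_E_odd (E F e k : int) (a m1 m2 : nat) (H : zmodType)
    (t : 'I_m1 -> H) (r : 'I_m2 -> H) (w z : H) :
  E = e * 2 + 1 -> m1%:Z = k * 2 ->
  a%:Z = leaf_order E F m1.+1 m2.+2 ->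
  leaf_basis (2 * a) 1 t r w z -> universal_leaf_pres E F m1.+1 m2.+2 H.
Proof.
move=> Ee m1k aE [[t2 r2] wa z0 Hlift Hext].
pose c : int := 2 * F + (m1%:Z - 1) * E.
pose d : int := F + 2 * k * e + k - e - 1.
have cd : c = 2 * d + 1 by rewrite /c /d Ee m1k; ring.
pose T := \sum_i t i; pose R := \sum_j r j.
have T2 : T *~ 2 = 0 by apply: sum_mulrz0.
have R2 : R *~ 2 = 0 by apply: sum_mulrz0.
rewrite PoszM in wa.
pose x := fcons (w *~ 2 + T) (fun i => w *~ 2 + t i).
exists x.
exists (fcons (w *~ c) (fcons (w *~ c + w *~ a + R) (fun j => w *~ c + r j))).
exists (w *~ 2 *~ (1 - m1%:Z)), (w *~ 2 *~ 2).
have xs : \sum_i x i = w *~ 2 *~ (1 - m1%:Z) + w *~ 2 *~ 2 *~ m1%:Z.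
  rewrite sum_fcons sum_ord_addl -/T.
  by apply: (eq_lin (c := 1) T2); zmod_coefs; ring.
split.
- split.
  + apply: ord_ind0 => [|i]; rewrite /x !(fcons0, fconsS).
      by apply: (eq_lin (c := 1) T2); zmod_coefs; ring.
    by apply: (eq_lin (c := 1) (t2 i)); zmod_coefs; ring.
  + by rewrite xs; zmod_coefs; ring.
  + apply: ord_ind0 => [|]; last apply: ord_ind0 => [|j]; rewrite !(fcons0, fconsS).
    * by rewrite /c; zmod_coefs; ring.
    * apply: (eq_lin (c := 1) wa); apply: (eq_lin (c := 1) R2).
      by rewrite /c; zmod_coefs; ring.
    * by apply: (eq_lin (c := 1) (r2 j)); rewrite /c; zmod_coefs; ring.
  + rewrite !sum_fcons sum_ord_addl -/R; apply: (eq_lin (c := 1) R2).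
    by rewrite aE /leaf_order /c; zmod_coefs; ring.
- move=> Q x' y' q0' q1' Qpres; have [x2 {}xs y2 ys] := Qpres.
  have D2 := leaf_pres_double2 Qpres.
  have [|u [q1E q0E]] := leaf_pres_root (k := k) _ Qpres.
    by rewrite -addn1 PoszD m1k.
  move: x2 xs y2 ys D2; rewrite q0E q1E !big_ord_recl => {q0E q1E Qpres} x2 xs y2 ys D2.
  have ua : u *~ a = 0.
    by rewrite aE; apply: (eq_lin (c := 1) D2); rewrite /leaf_order; zmod_coefs; ring.
  (* The equation [y' ord0 *~ 2 = u *~ c] with [c = 2 * d + 1] exhibits a half of [u]. *)
  have W2 : (y' ord0 - u *~ d) *~ 2 = u.
    apply: (eq_lin (c := 1) (y2 ord0)); zmod_coefs; first by ring.
    by rewrite /d Ee -[m1.+1]addn1 PoszD m1k; ring.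
  set w' := y' ord0 - u *~ d in W2.
  have yc : w' *~ c = y' ord0.
    by apply: (eq_lin (c := d) W2); rewrite cd /w'; zmod_coefs; ring.
  have [|||g [gt gr gw _]] := Hlift Q (fun i => x' (lift ord0 i) - u)
      (fun j => y' (lift ord0 (lift ord0 j)) - w' *~ c) w' 0 _ _ _ (mul0rz _ _).
  + by move=> i; apply: (eq_lin (c := 1) (x2 (lift ord0 i))); zmod_coefs; ring.
  + move=> j; apply: (eq_lin (c := 1) (y2 (lift ord0 (lift ord0 j)))).
    by apply: (eq_lin (c := - c) W2); rewrite /c; zmod_coefs; ring.
  + by apply: (eq_lin (c := a%:Z) W2); apply: (eq_lin (c := 1) ua); zmod_coefs; ring.
  exists g; split.
    apply: ord_ind0 => [|i]; rewrite /x !(fcons0, fconsS) raddfD raddfMz gw ?gt.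
      rewrite raddf_sum (eq_bigr _ (fun i _ => gt i)) sum_ord_subr.
      apply: (eq_lin (c := 1) W2); apply: (eq_lin (c := 1) xs).
      by apply: (eq_lin (c := -1) (x2 ord0)); zmod_coefs; ring.
    by apply: (eq_lin (c := 1) W2); zmod_coefs; ring.
  apply: ord_ind0 => [|]; last apply: ord_ind0 => [|j]; rewrite !(fcons0, fconsS).
  + by rewrite raddfMz gw.
  + rewrite !raddfD !raddfMz gw raddf_sum (eq_bigr _ (fun i _ => gr i)) !sum_ord_subr.
    apply: (eq_lin (c := 1) ys); apply: (eq_lin (c := -1) (y2 (lift ord0 ord0))).
    apply: (eq_lin (c := 1) ua); apply: (eq_lin (c := 1) yc).
    apply: (eq_lin (c := 2 * (3 * F - E) + (m1%:Z - 1) * F) W2).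
    by rewrite aE /leaf_order /c; zmod_coefs; ring.
  + by rewrite raddfD raddfMz gw gr addrC subrK.
- move=> g gx gy.
  have gw2 : g (w *~ 2) = w *~ 2.
    (* [T] disappears because [m1] is even. *)
    have -> : w *~ 2 = \sum_i x i - x ord0 *~ m1.
      rewrite xs /x fcons0; apply: (eq_lin (c := k) T2).
      by rewrite m1k; zmod_coefs; ring.
    by rewrite raddfB raddfMz gx raddf_sum; congr (_ - _); apply: eq_bigr.
  have gw : g w = w.
    have := gy ord0; rewrite fcons0 cd mulrzDr mulrzA mulr1z.
    by rewrite raddfD raddfMz gw2 => /addrI.
  apply: Hext => // [i|j|].
  + by have := gx (lift ord0 i); rewrite /x fconsS raddfD gw2 => /addrI.
  + by have := gy (lift ord0 (lift ord0 j)); rewrite !fconsS raddfD raddfMz gw => /addrI.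
  + by have -> : z = 0 by []; rewrite raddf0.
Qed.

(** The sum relation now equates the only leaf at pi_p with the virtual successor of pi_p. This is a
    relation on [w] itself, which gets order [a] instead of [2 * a]. *)
Lemma universal_odd_E_odd_one (E F e k : int) (a m1 : nat) (H : zmodType)
    (t : 'I_m1 -> H) (r : 'I_0 -> H) (w z : H) :
  E = e * 2 + 1 -> m1%:Z = k * 2 ->
  a%:Z = leaf_order E F m1.+1 1 ->
  leaf_basis a 1 t r w z -> universal_leaf_pres E F m1.+1 1 H.
Proof.
move=> Ee m1k aE [[t2 _] wa z0 Hlift Hext].
pose c : int := 2 * F + (m1%:Z - 1) * E.
pose d : int := F + 2 * k * e + k - e - 1.
have cd : c = 2 * d + 1 by rewrite /c /d Ee m1k; ring.
pose T := \sum_i t i.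
have T2 : T *~ 2 = 0 by apply: sum_mulrz0.
pose x := fcons (w *~ 2 + T) (fun i => w *~ 2 + t i).
exists x, (fun=> w *~ c), (w *~ 2 *~ (1 - m1%:Z)), (w *~ 2 *~ 2).
have xs : \sum_i x i = w *~ 2 *~ (1 - m1%:Z) + w *~ 2 *~ 2 *~ m1%:Z.
  rewrite sum_fcons sum_ord_addl -/T.
  by apply: (eq_lin (c := 1) T2); zmod_coefs; ring.
split.
- split.
  + apply: ord_ind0 => [|i]; rewrite /x !(fcons0, fconsS).
      by apply: (eq_lin (c := 1) T2); zmod_coefs; ring.
    by apply: (eq_lin (c := 1) (t2 i)); zmod_coefs; ring.
  + by rewrite xs; zmod_coefs; ring.
  + by move=> _; rewrite /c; zmod_coefs; ring.
  + rewrite big_ord1; apply: (eq_lin (c := -1) wa).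
    by rewrite aE /leaf_order /c; zmod_coefs; ring.
- move=> Q x' y' q0' q1' Qpres; have [x2 {}xs y2 ys] := Qpres.
  have [|u [q1E q0E]] := leaf_pres_root (k := k) _ Qpres.
    by rewrite -addn1 PoszD m1k.
  move: x2 xs y2 ys; rewrite q0E q1E big_ord_recl big_ord1 => {q0E q1E Qpres} x2 xs y2 ys.
  have W2 : (y' ord0 - u *~ d) *~ 2 = u.
    apply: (eq_lin (c := 1) (y2 ord0)); zmod_coefs; first by ring.
    by rewrite /d Ee -[m1.+1]addn1 PoszD m1k; ring.
  set w' := y' ord0 - u *~ d in W2.
  have yc : w' *~ c = y' ord0.
    by apply: (eq_lin (c := d) W2); rewrite cd /w'; zmod_coefs; ring.
  have [|||g [gt _ gw _]] := Hlift Q (fun i => x' (lift ord0 i) - u)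
      (fun=> 0) w' 0 _ _ _ (mul0rz _ _).
  + by move=> i; apply: (eq_lin (c := 1) (x2 (lift ord0 i))); zmod_coefs; ring.
  + by move=> j; rewrite mul0rz.
  + apply: (eq_lin (c := 2 * (3 * F - E) + (m1%:Z - 1) * F) W2).
    apply: (eq_lin (c := -1) yc); apply: (eq_lin (c := -1) ys).
    by rewrite aE /leaf_order /c; zmod_coefs; ring.
  exists g; split=> [|j]; last by rewrite raddfMz gw yc (ord1 j).
  apply: ord_ind0 => [|i]; rewrite /x !(fcons0, fconsS) raddfD raddfMz gw ?gt.
    rewrite raddf_sum (eq_bigr _ (fun i _ => gt i)) sum_ord_subr.
    apply: (eq_lin (c := 1) W2); apply: (eq_lin (c := 1) xs).
    by apply: (eq_lin (c := -1) (x2 ord0)); zmod_coefs; ring.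
  by apply: (eq_lin (c := 1) W2); zmod_coefs; ring.
- move=> g gx gy.
  have gw2 : g (w *~ 2) = w *~ 2.
    have -> : w *~ 2 = \sum_i x i - x ord0 *~ m1.
      rewrite xs /x fcons0; apply: (eq_lin (c := k) T2).
      by rewrite m1k; zmod_coefs; ring.
    by rewrite raddfB raddfMz gx raddf_sum; congr (_ - _); apply: eq_bigr.
  have gw : g w = w.
    have := gy ord0; rewrite cd mulrzDr mulrzA mulr1z.
    by rewrite raddfD raddfMz gw2 => /addrI.
  apply: Hext => // [i|[]//|].
  + by have := gx (lift ord0 i); rewrite /x fconsS raddfD gw2 => /addrI.
  + by have -> : z = 0 by []; rewrite raddf0.
Qed.

(** Let [w] and [v] be the first leaves at pi_1 and pi_p, and [z = v - w *~ h]. Then [z *~ 2] is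
    [q0 + w *~ (2 * k)] times [- E], and [leaf_pres_double1] says that the double of this sum
    vanishes; hence [z *~ 4 = 0]. *)
Lemma universal_odd_E_even (E F e k l : int) (a m1 m2 : nat) (H : zmodType)
    (t : 'I_m1 -> H) (r : 'I_m2 -> H) (w z : H) :
  E = e * 2 + 1 -> m1%:Z = k * 2 -> m2%:Z = l * 2 ->
  a%:Z = leaf_order E F m1.+2 m2.+2 ->
  leaf_basis a 4 t r w z -> universal_leaf_pres E F m1.+2 m2.+2 H.
Proof.
move=> Ee m1k m2l aE [[t2 r2] wa z4 Hlift Hext].
have m1E : m1.+2%:Z = k * 2 + 2 by rewrite -m1k -addn2.
have m2E : m2.+2%:Z = l * 2 + 2 by rewrite -m2l -addn2.
pose h : int := F + k * E.
pose a2 : int := 2 * (3 * F - E) + 2 * k * F + 2 * l * h.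
have {}aE : a%:Z = 2 * a2.
  by rewrite aE /leaf_order /a2 /h m1E m2E; ring.
pose T := \sum_i t i; pose R := \sum_j r j.
have T2 : T *~ 2 = 0 by apply: sum_mulrz0.
have R2 : R *~ 2 = 0 by apply: sum_mulrz0.
(* Since E is odd, [z *~ 2] equals [q0 + w *~ (2 * k)], which fixes [q0]; the sum relations then fix
   the second leaf on each side. *)
exists (fcons w (fcons (w + z *~ 2 + T) (fun i => w + t i))).
exists (fcons (z + w *~ h) (fcons (z + w *~ h + w *~ a2 + z *~ (2 * (l - F)) + R)
          (fun j => z + w *~ h + r j))).
exists (z *~ 2 - w *~ (2 * k)), (w *~ 2); split.
- split.
  + apply: ord_ind0 => [|]; last apply: ord_ind0 => [|i]; rewrite !(fcons0, fconsS) //.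
      apply: (eq_lin (c := 1) z4); apply: (eq_lin (c := 1) T2).
      by zmod_coefs; ring.
    by apply: (eq_lin (c := 1) (t2 i)); zmod_coefs; ring.
  + rewrite !sum_fcons sum_ord_addl -/T; apply: (eq_lin (c := 1) T2).
    by rewrite m1E m1k; zmod_coefs; ring.
  + apply: ord_ind0 => [|]; last apply: ord_ind0 => [|j]; rewrite !(fcons0, fconsS);
      apply: (eq_lin (c := e + 1) z4).
    * by rewrite /h Ee; zmod_coefs; ring.
    * apply: (eq_lin (c := 1) wa); apply: (eq_lin (c := 1) R2).
      apply: (eq_lin (c := l - F) z4).
      by rewrite aE /h Ee; zmod_coefs; ring.
    * by apply: (eq_lin (c := 1) (r2 j)); rewrite /h Ee; zmod_coefs; ring.
  + rewrite !sum_fcons sum_ord_addl -/R; apply: (eq_lin (c := 1) R2).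
    apply: (eq_lin (c := 2 * l + 2 * e * l + e + 1) z4).
    by rewrite m2E m2l /a2 /h Ee; zmod_coefs; ring.
- move=> Q x' y' q0' q1' Qpres; have [x2 xs y2 ys] := Qpres.
  have Q0 := leaf_pres_double1 Qpres; have D2 := leaf_pres_double2 Qpres.
  move: x2 xs y2 ys Q0 D2; rewrite !big_ord_recl m1E m2E => x2 xs y2 ys Q0 D2.
  have q1E := x2 ord0; set u := x' ord0 in xs q1E *; subst q1'.
  have v2 := y2 ord0; set v := y' ord0 in ys v2 *.
  have ua : u *~ a = 0.
    apply: (eq_lin (c := 1) D2); apply: (eq_lin (c := F + l * E) Q0).
    by rewrite aE /a2 /h; zmod_coefs; ring.
  have [|||g [gt gr gw gz]] := Hlift Q (fun i => x' (lift ord0 (lift ord0 i)) - u)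
      (fun j => y' (lift ord0 (lift ord0 j)) - v) u (v - u *~ h) _ _ ua _.
  + move=> i; apply: (eq_lin (c := 1) (x2 (lift ord0 (lift ord0 i)))).
    by zmod_coefs; ring.
  + move=> j; apply: (eq_lin (c := 1) (y2 (lift ord0 (lift ord0 j)))).
    by apply: (eq_lin (c := -1) v2); zmod_coefs; ring.
  + apply: (eq_lin (c := 2) v2); apply: (eq_lin (c := - E) Q0).
    by rewrite /h; zmod_coefs; ring.
  have gv : g (z + w *~ h) = v by rewrite raddfD raddfMz gw gz subrK.
  exists g; split.
    apply: ord_ind0 => [|]; last apply: ord_ind0 => [|i]; rewrite !(fcons0, fconsS) //.
      rewrite 2!raddfD raddfMz gw gz raddf_sum (eq_bigr _ (fun i _ => gt i)) sum_ord_subr.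
      apply: (eq_lin (c := 1) xs); apply: (eq_lin (c := 1) v2).
      apply: (eq_lin (c := -1) (x2 (lift ord0 ord0))); apply: (eq_lin (c := - e) Q0).
      by rewrite m1k /h Ee; zmod_coefs; ring.
    by rewrite raddfD gw gt addrC subrK.
  apply: ord_ind0 => [|]; last apply: ord_ind0 => [|j]; rewrite !(fcons0, fconsS) //.
    rewrite !raddfD !raddfMz gw gz raddf_sum (eq_bigr _ (fun i _ => gr i)) sum_ord_subr.
    apply: (eq_lin (c := 1) ys); apply: (eq_lin (c := -1) (y2 (lift ord0 ord0))).
    apply: (eq_lin (c := - F) v2); apply: (eq_lin (c := e * F - l * E) Q0).
    apply: (eq_lin (c := 1) ua).
    by rewrite m2l aE /a2 /h Ee; zmod_coefs; ring.
  by rewrite raddfD gv gr addrC subrK.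
- move=> g gx gy.
  have gw : g w = w by have := gx ord0; rewrite fcons0.
  have gy0 : g (z + w *~ h) = z + w *~ h by have := gy ord0; rewrite fcons0.
  apply: Hext => // [i|j|].
  + by have := gx (lift ord0 (lift ord0 i)); rewrite !fconsS raddfD gw => /addrI.
  + by have := gy (lift ord0 (lift ord0 j)); rewrite !fconsS raddfD gy0 => /addrI.
  + by move: gy0; rewrite raddfD raddfMz gw => /addIr.
Qed.

(** * Concrete groups with a leaf basis *)

Lemma Zp_mulrn_order (n : nat) (x : 'Z_n) : (1 < n)%N -> x *+ n = 0.
Proof.
by move=> n1; rewrite Zp_mulrn; apply: val_inj; rewrite /= [X in (_ %% X)%N]Zp_cast // modnMl.
Qed.

Lemma rVZ2_double n (v : 'rV['Z_2]_n) : v *+ 2 = 0.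
Proof. by apply/rowP => i; rewrite mulmxnE mxE Zp_mulrn_order. Qed.

Lemma rVZ2_lift2 (Q : zmodType) m1 m2 (t : 'I_m1 -> Q) (r : 'I_m2 -> Q) :
  (forall i, t i *~ 2 = 0) -> (forall j, r j *~ 2 = 0) ->
  exists g : {additive 'rV['Z_2]_(m1 + m2) -> Q},
    (forall i, g (delta_mx 0 (lshift m2 i)) = t i) /\
    (forall j, g (delta_mx 0 (rshift m1 j)) = r j).
Proof.
move=> t2 r2; pose e k := match split k with inl i => t i | inr j => r j end.
have e2 k : e k *~ 2%N = 0 by rewrite /e; case: split.
have [g gE] := rVZp_lift (ltnSn 1) e2.
exists g; split=> [i|j]; rewrite gE /e.
  by rewrite (unsplitK (inl i : 'I_m1 + 'I_m2)).
by rewrite (unsplitK (inr j : 'I_m1 + 'I_m2)).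
Qed.

Lemma leaf_basis_Z2_Zp (a m1 m2 : nat) : (1 < a)%N ->
  leaf_basis a 1 (H := ('rV['Z_2]_(m1 + m2) * 'Z_a)%type)
    (fun i => (delta_mx 0 (lshift m2 i), 0)) (fun j => (delta_mx 0 (rshift m1 j), 0))
    (0, 1) 0.
Proof.
move=> a1; split.
- by split=> i; rewrite [LHS]pair_mulrn rVZ2_double [X in (_, X)]mul0rn.
- by rewrite [LHS]pair_mulrn /= mul0rn Zp_mulrn_order //.
- by rewrite mul0rz.
- move=> Q t' r' w' z' t2 r2 wa z0.
  have [g1 [g1t g1r]] := rVZ2_lift2 t2 r2.
  have [g2 g2E] := Zp_lift a1 wa.
  have [g gE] := pair_lift g1 g2.
  by exists g; split=> [i|j||]; rewrite ?gE ?raddf0 /= ?raddf0 ?addr0 ?add0r.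
- move=> g gt gr gw _; apply: pair_ind_add => [u v|u|v].
  + by rewrite raddfD => -> ->.
  + pose P (u : 'rV['Z_2]_(m1 + m2)) := g (u, 0) = (u, 0).
    apply: (@rVZp_ind_add _ _ P) => [|v1 v2|i]; rewrite /P; first exact: raddf0.
      have -> : (v1 + v2, 0 : 'Z_a) = (v1, 0) + (v2, 0) by congr pair; rewrite addr0.
      by rewrite raddfD => -> ->.
    by case: (split_ordP i) => j ->.
  + pose P (v : 'Z_a) := g (0, v) = (0, v).
    apply: (@Zp_ind_add _ P) => [|v1 v2|]; rewrite /P //; first exact: raddf0.
    have -> : (0, v1 + v2) = (0, v1) + (0, v2) :> ('rV['Z_2]_(m1 + m2) * 'Z_a)%type.
      by congr pair; rewrite addr0.
    by rewrite raddfD => -> ->.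
Qed.

Lemma leaf_basis_Z2_Z4_Zp (a m1 m2 : nat) : (1 < a)%N ->
  leaf_basis a 4 (H := ('rV['Z_2]_(m1 + m2) * ('Z_4 * 'Z_a))%type)
    (fun i => (delta_mx 0 (lshift m2 i), 0)) (fun j => (delta_mx 0 (rshift m1 j), 0))
    (0, (0, 1)) (0, (1, 0)).
Proof.
move=> a1; set H := (_ * _)%type.
split.
- by split=> i; rewrite [LHS]pair_mulrn rVZ2_double [X in (_, X)]mul0rn.
- by rewrite [LHS]pair_mulrn /= pair_mulrn /= !mul0rn Zp_mulrn_order.
- by rewrite [LHS]pair_mulrn [X in (_, X)]pair_mulrn !mul0rn Zp_mulrn_order.
- move=> Q t' r' w' z' t2 r2 wa z4.
  have [g1 [g1t g1r]] := rVZ2_lift2 t2 r2.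
  have [g2 g2E] := Zp_lift a1 wa.
  have [g3 g3E] := Zp_lift (isT : 1 < 4)%N z4.
  have [g4 g4E] := pair_lift g3 g2.
  have [g gE] := pair_lift g1 g4.
  by exists g; split=> [i|j||]; rewrite ?gE /= ?g4E /= ?raddf0 ?addr0 ?add0r.
- move=> g gt gr gw gz; apply: pair_ind_add => [u v|u|v].
  + by rewrite raddfD => -> ->.
  + pose P (u : 'rV['Z_2]_(m1 + m2)) := g (u, 0) = (u, 0).
    apply: (@rVZp_ind_add _ _ P) => [|v1 v2|i]; rewrite /P; first exact: raddf0.
      have -> : (v1 + v2, 0) = (v1, 0) + (v2, 0) :> H by congr pair; rewrite addr0.
      by rewrite raddfD => -> ->.
    by case: (split_ordP i) => j ->.
  + pose P v := g (0, v) = (0, v) :> H; rewrite -/(P v).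
    have PD v1 v2 : P v1 -> P v2 -> P (v1 + v2).
      rewrite /P; have -> : (0, v1 + v2) = (0, v1) + (0, v2) :> H.
        by congr pair; rewrite addr0.
      by rewrite raddfD => -> ->.
    apply: pair_ind_add => // y.
      apply: (@Zp_ind_add _ (fun y => P (y, 0))) => // [|y1 y2]; first exact: raddf0.
      have -> : (y1 + y2, 0) = (y1, 0) + (y2, 0) :> ('Z_4 * 'Z_a)%type.
        by congr pair; rewrite addr0.
      exact: PD.
    apply: (@Zp_ind_add _ (fun y => P (0, y))) => // [|y1 y2]; first exact: raddf0.
    have -> : (0, y1 + y2) = (0, y1) + (0, y2) :> ('Z_4 * 'Z_a)%type.
      by congr pair; rewrite addr0.
    exact: PD.
Qed.

Lemma mulrn_odd_double (Q : zmodType) (t : Q) a : odd a -> t *~ 2 = 0 -> t *+ a = t.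
Proof.
move=> oa t2; rewrite -(odd_double_half a) oa mulrnDr -muln2 mulnC mulrnA.
by rewrite (t2 : t *+ 2 = 0) mul0rn addr0.
Qed.

Lemma mulSn_odd a : odd a -> (a.+1 * a = 2 * a * a.+1./2)%N.
Proof.
move=> oa; have h : a.+1 = (2 * a.+1./2)%N by rewrite mul2n even_halfK //= oa.
by rewrite [in LHS]h mulnAC.
Qed.

(* For odd [a], Z_2a is the sum of the copy of Z_2 generated by [a] and of the
   copy of Z_a generated by [a + 1]. *)
Lemma leaf_basis_Z2_Zp_odd (a m : nat) : (1 < a)%N -> odd a ->
  leaf_basis a 1 (H := ('rV['Z_2]_m * 'Z_(2 * a))%type)
    (fcons (0, a%:R) (fun i => (delta_mx 0 i, 0))) (fun _ : 'I_0 => 0)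
    (0, a.+1%:R) 0.
Proof.
move=> a1 oa; set H := (_ * _)%type.
have a2 : (1 < 2 * a)%N by lia.
have natE k : (0, k%:R) = (0, 1) *+ k :> H by rewrite pair_mulrn /= mul0rn.
have w2a : (0, 1) *+ (2 * a) = 0 :> H by rewrite pair_mulrn /= mul0rn Zp_mulrn_order.
split.
- split=> [|[]//]; apply: ord_ind0 => [|i]; rewrite !(fcons0, fconsS).
    have -> : (0, a%:R) *~ 2 = (0, 1) *+ (2 * a) :> H by rewrite natE mulrnA mulrnAC.
    by rewrite w2a.
  by rewrite [LHS]pair_mulrn rVZ2_double [X in (_, X)]mul0rn.
- by rewrite natE -[LHS]mulrnA (mulSn_odd oa) mulrnA w2a mul0rn.
- by rewrite mul0rz.
- move=> Q t' r' w' z' t2 _ wa z0.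
  have [g1 g1E] := rVZp_lift (isT : 1 < 2)%N (fun i => t2 (lift ord0 i)).
  (* The image of 1 is forced, because [a + (a + 1)] is 1 modulo [2 * a]. *)
  have [|g2 g2E] := @Zp_lift Q (2 * a) (t' ord0 + w') a2.
    apply: (eq_lin (c := a%:Z) (t2 ord0)); apply: (eq_lin (c := 2) wa).
    by rewrite PoszM; zmod_coefs; ring.
  have [g gE] := pair_lift g1 g2.
  have gn k : g (0, k%:R) = (t' ord0 + w') *+ k.
    by rewrite natE raddfMn gE /= raddf0 add0r g2E.
  have ta := mulrn_odd_double oa (t2 ord0); rewrite -[_ *+ a]/(_ *~ a) in ta.
  exists g; split=> [|[]//||]; last by rewrite raddf0 -z0 mulr1z.
    apply: ord_ind0 => [|i]; rewrite !(fcons0, fconsS).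
      rewrite gn -[LHS]/(_ *~ a).
      by apply: (eq_lin (c := 1) ta); apply: (eq_lin (c := 1) wa); zmod_coefs; ring.
    by rewrite gE /= g1E raddf0 addr0.
  rewrite gn -[LHS]/(_ *~ a.+1); apply: (eq_lin (c := 1) ta).
  apply: (eq_lin (c := 1) wa); apply: (eq_lin (c := 1) (t2 ord0)).
  by zmod_coefs; ring.
- move=> g gt _ gw _; apply: pair_ind_add => [u v|u|v].
  + by rewrite raddfD => -> ->.
  + pose P (u : 'rV['Z_2]_m) := g (u, 0) = (u, 0).
    apply: (@rVZp_ind_add _ _ P) => [|v1 v2|i]; rewrite /P; first exact: raddf0.
      have -> : (v1 + v2, 0) = (v1, 0) + (v2, 0) :> H by congr pair; rewrite addr0.
      by rewrite raddfD => -> ->.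
    by have := gt (lift ord0 i); rewrite fconsS.
  + have g1 : g (0, 1) = (0, 1).
      have := gt ord0; rewrite fcons0 => ga.
      have -> : (0, 1) = (0, a.+1%:R) - (0, a%:R) :> H.
        by rewrite (natE a) (natE a.+1) mulrS addrK.
      by rewrite raddfB ga gw.
    by rewrite -[v]natr_Zp natE raddfMn g1.
Qed.

Lemma zmod_iso_pairr (U V W : zmodType) :
  zmod_iso V W -> zmod_iso (U * V)%type (U * W)%type.
Proof.
move=> [f [g fK gK]].
have hD : {morph (fun z : U * V => (z.1, f z.2)) : x y / x + y}.
  by move=> x y; rewrite /= raddfD.
have [h hE] := additive_build hD.
apply: (@zmod_iso_build _ _ h (fun z => (z.1, g z.2))) => -[u v];
  by rewrite hE /= ?fK ?gK.
Qed.

(** Chinese remainder theorem: the generators of Z_2 and Z_a go to the idempotents [a] and [a + 1]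
    of Z_2a. The trivial factor ['rV['Z_2]_0] comes from [leaf_basis_Z2_Zp] with [m1 = m2 = 0]. *)
Lemma Z2_Zp_iso (a : nat) : (1 < a)%N -> odd a ->
  zmod_iso ('rV['Z_2]_1 * ('rV['Z_2]_0 * 'Z_a))%type 'Z_(2 * a).
Proof.
move=> a1 oa; have a2 : (1 < 2 * a)%N by lia.
set H := (_ * _)%type.
have natE k : (0, k%:R) = (0, 1) *+ k :> ('rV['Z_2]_0 * 'Z_a)%type.
  by rewrite pair_mulrn /= mul0rn.
have aZ : a%:R = 0 :> 'Z_a by rewrite Zp_mulrn_order.
have [|g gE] := @Zp_lift H (2 * a) (delta_mx 0 0, (0, 1)) a2.
  by rewrite [LHS]pair_mulrn /= mulrnA rVZ2_double mul0rn -natE natrM aZ mulr0.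
have [|f1 f1E] := @rVZp_lift 'Z_(2 * a) 2 1 (fun=> a%:R) isT.
  by move=> _; rewrite -[LHS]mulrnA [(a * _)%N]mulnC Zp_mulrn_order.
have [|f2 f2E] := @Zp_lift 'Z_(2 * a) a a.+1%:R a1.
  by rewrite -[LHS]mulrnA (mulSn_odd oa) mulrnA Zp_mulrn_order // mul0rn.
have [f0 _] := additive_build (f := fun _ : 'rV['Z_2]_0 => 0 : 'Z_(2 * a))
   (fun _ _ => esym (addr0 _)).
have [f3 f3E] := pair_lift f0 f2; have [f fE] := pair_lift f1 f3.
apply: (@zmod_iso_build _ _ f g) => [|y].
  apply: pair_ind_add => [x y|u|[v y]].
  - by rewrite !raddfD => -> ->.
  - rewrite fE /= raddf0 addr0.
    apply: (@rVZp_ind_add _ _ (fun u => g (f1 u) = (u, 0))) => [|v1 v2|i].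
    + by rewrite !raddf0.
    + by rewrite !raddfD => -> ->; congr pair; rewrite addr0.
    + rewrite f1E raddfMn gE pair_mulrn /= -natE (ord1 i).
      rewrite mulrn_odd_double //; last exact: rVZ2_double.
      by rewrite aZ.
  - rewrite (thinmx0 v) fE /= raddf0 add0r f3E /= raddf0 add0r.
    rewrite -[y]natr_Zp raddfMn f2E -mulrnA raddfMn gE.
    rewrite pair_mulrn /= -natE mulrnA.
    have -> : delta_mx 0 0 *+ a.+1 = 0 :> 'rV['Z_2]_1.
      by rewrite mulrS mulrn_odd_double //; exact: rVZ2_double.
    by rewrite mul0rn natrM mulrS aZ addr0 mul1r.
rewrite -[y]natr_Zp !raddfMn gE fE /= f1E f3E /= raddf0 add0r f2E; congr (_ *+ _).
by rewrite -natrD addnS addnn -mul2n mulrS Zp_mulrn_order // addr0.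
Qed.

(** * Fibonacci numbers and the order of the cyclic factor *)

Lemma evenfib_cassini n :
  evenfib n.+1 ^+ 2 - 3 * evenfib n.+1 * evenfib n + evenfib n ^+ 2 = 1.
Proof.
elim: n => [//|n IH]; rewrite evenfib_rec -[RHS]IH; ring.
Qed.

(** Modulo 2 the recurrence is that of the Fibonacci numbers, of period 3. *)
Lemma evenfib_parity n : exists e f : int,
  evenfib n = e * 2 + (n %% 3 != 0)%N%:R /\ evenfib n.+1 = f * 2 + (n %% 3 != 2)%N%:R.
Proof.
elim: n => [|n [e [f [eE fE]]]]; first by exists 0, 0.
have -> : (n.+1 %% 3 = (n %% 3).+1 %% 3)%N by rewrite -(addn1 n) -(addn1 (n %% 3)) modnDml.
have := ltn_pmod n (isT : 0 < 3)%N; rewrite evenfib_rec; move: eE fE.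
case: (n %% 3)%N => [|[|[|//]]] /= -> -> _.
- by exists f, (3 * f - e + 1); split; ring.
- by exists f, (3 * f - e + 1); split; ring.
- by exists f, (3 * f - e - 1); split; ring.
Qed.

(** With [s1 = s + 1], [c n] is the coefficient of [u] in pi_(n+1) when [q1 = u *~ 2] and
    [q0 = u *~ (2 - s1)]. *)
Lemma coconut_bnat_evenfib s n (c := fun k => (2 * evenfib k.+1 + (s%:Z - 1) * evenfib k : int)) :
  (coconut_bnat s.+1 n.*2)%:Z = 2 ^+ s * c n /\
  (coconut_bnat s.+1 n.*2.+1)%:Z = 2 ^+ s * (c n.+1 - c n).
Proof.
elim: n => [|n [IH1 IH2]].
  have [f0 f1] : evenfib 0 = 0 /\ evenfib 1 = 1 by [].
  rewrite /c !evenfib_rec f0 f1 /= subSS subn0 PoszM.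
  have P2 k : (2 ^ k)%N%:Z = 2 ^+ k by rewrite -natz natrX.
  by split; rewrite !P2 ?exprS ?PoszD; ring.
rewrite doubleS /= !PoszD IH2 IH1 /c !evenfib_rec.
by split; ring.
Qed.

Lemma coconut_a_leaf_order n s1 s2 : (0 < s1)%N ->
  (coconut_a n.+1 s1 s2)%:Z = leaf_order (evenfib n) (evenfib n.+1) s1 s2.
Proof.
case: s1 => // s _; rewrite /coconut_a /coconut_b.
(* [coconut_bnat] is shifted by 2, so for p = n + 1 the indices 2p - 3 and 2p - 4 become 2n + 1 and
   2n. *)
have -> : absz (2 * n.+1%:Z - 3 + 2) = n.*2.+1 by lia.
have -> : absz (2 * n.+1%:Z - 4 + 2) = n.*2 by lia.
have [b0 b1] := coconut_bnat_evenfib s n.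
set L := leaf_order _ _ _ _; set N := (2 * _)%N.
have NE : N%:Z = 2 ^+ s.+1 * L.
  rewrite /N PoszM PoszD !PoszM b0 b1 /L /leaf_order !evenfib_rec exprS.
  by ring.
have L0 : 0 <= L by rewrite -(@pmulr_rge0 _ (2 ^+ s.+1)) ?exprn_gt0 // -NE.
rewrite -(gez0_abs L0); congr Posz.
have -> : N = (2 ^ s.+1 * absz L)%N.
  apply/eqP; rewrite -eqz_nat NE PoszM (gez0_abs L0); apply/eqP; congr (_ * _).
  by rewrite -natz natrX.
by rewrite mulKn // expn_gt0.
Qed.

Lemma leaf_order_sym E F s1 s2 : leaf_order E F s1 s2 = leaf_order E F s2 s1.
Proof. by rewrite /leaf_order; ring. Qed.

Lemma even_PoszE m : ~~ odd m -> m%:Z = (m./2)%:Z * 2.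
Proof. lia. Qed.

Lemma has_exponent_Z2_Zp d m : has_exponent ('rV['Z_2]_m * 'Z_d)%type.
Proof.
apply: has_exponent_pair; last exact: has_exponent_Zp.
exact/has_exponent_rV/has_exponent_Zp.
Qed.

(** For [s2 = 1] the group found is the sum of [s1 - 1] copies of Z_2 and of Z_a, and one Z_2 has to
    be merged with Z_a. If [s1 = 1] too, there is no such copy: the exponent is -1 and the Z_2 is
    added to [K] instead. *)
Lemma iso_Z2pow_odd (K : zmodType) (E F e : int) (s1 s2 a : nat) :
  (0 < s2)%N -> odd s1 -> (1 < a)%N -> E = e * 2 + 1 ->
  a%:Z = leaf_order E F s1 s2 ->
  (forall H, has_exponent H -> universal_leaf_pres E F s1 s2 H -> zmod_iso K H) ->
  iso_Z2pow_sum K (s1%:Z + s2%:Z - 3) 'Z_(2 * a).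
Proof.
case: s1 s2 => // m1 [//|[|m2]] _ /= /even_PoszE m1k a1 Ee aE Kiso; last first.
  have -> : m1.+1%:Z + m2.+2%:Z - 3 = (m1 + m2)%N by lia.
  apply: Kiso; first exact: has_exponent_Z2_Zp.
  apply: (universal_odd_E_odd Ee m1k aE (leaf_basis_Z2_Zp m1 m2 _)); lia.
(* In the last term of [leaf_order], [s1 - 2], [s2 - 2] and E are all odd; the other terms are
   even. *)
have oa : odd a.
  have : a%:Z = 2 * (2 * (3 * F - E) + (m1%:Z - 2) * F - m1./2%:Z * E + e) + 1.
    by rewrite aE /leaf_order [in LHS]Ee -[m1.+1]addn1 PoszD m1k Ee; ring.
  lia.
case: m1 m1k aE Kiso => [|m] m1k aE Kiso.
  have isoK : zmod_iso K ('rV['Z_2]_0 * 'Z_a)%type.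
    apply: Kiso; first exact: has_exponent_Z2_Zp.
    exact: (universal_odd_E_odd_one Ee m1k aE (leaf_basis_Z2_Zp 0 0 a1)).
  exact: zmod_iso_trans (zmod_iso_pairr _ isoK) (Z2_Zp_iso a1 oa).
have -> : m.+2%:Z + 1%N - 3 = m by lia.
apply: Kiso; first exact: has_exponent_Z2_Zp.
exact: (universal_odd_E_odd_one Ee m1k aE (leaf_basis_Z2_Zp_odd m a1 oa)).
Qed.

Theorem theorem1p3 (p s1 s2 : nat)
    (hp : (1 <= p)%N) (hs1 : (1 <= s1)%N) (hs2 : (1 <= s2)%N) :
  let a := coconut_a p s1 s2 in
  let K := sandpile (Cone (bicoconut p s1 s2)) in
  [/\ (p = 1 %[mod 3])%N ->
        iso_Z2pow_sum K (s1%:Z + s2%:Z - 2) 'Z_a,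
      odd s1 \/ odd s2 -> (p <> 1 %[mod 3])%N ->
        iso_Z2pow_sum K (s1%:Z + s2%:Z - 3) 'Z_(2 * a)%N
    & ~~ odd s1 /\ ~~ odd s2 -> (p <> 1 %[mod 3])%N ->
        iso_Z2pow_sum K (s1%:Z + s2%:Z - 4) ('Z_4 * 'Z_a)%type].
Proof.
case: p hp => // n _ a K.
have a1 : (1 < a)%N := coconut_a_gt1 n.+1 s2 hs1.
have aE := coconut_a_leaf_order n s2 hs1; rewrite -/a in aE.
have cassini := evenfib_cassini n.
have [e [f [Ee Ff]]] := evenfib_parity n.
have Kiso H : has_exponent H ->
    universal_leaf_pres (evenfib n) (evenfib n.+1) s1 s2 H -> zmod_iso K H.
  exact: sandpile_bicoconut_iso.
clearbody a K.
have n3 : (n.+1 = 1 %[mod 3])%N <-> (n %% 3 = 0)%N by split; lia.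
split=> [/n3 n0|odd12 /n3 n0|[ev1 ev2] /n3 n0].
- have -> : s1%:Z + s2%:Z - 2 = (s1.-1 + s2.-1)%N by lia.
  apply: Kiso; first exact: has_exponent_Z2_Zp.
  move: aE; case: s1 s2 hs1 hs2 => // m1 [|m2] // _ _ aE.
  apply: (universal_even_E (e := e) (f := f) _ _ aE (leaf_basis_Z2_Zp m1 m2 a1)).
    by rewrite Ee n0 addr0.
  by rewrite Ff n0.
- have {}Ee : evenfib n = e * 2 + 1 by rewrite Ee; case: eqP.
  case: odd12 => [o1|o2]; first exact: iso_Z2pow_odd hs2 o1 a1 Ee aE Kiso.
  (* The odd side has to take the role of [s1], so the path is read backwards. *)
  rewrite leaf_order_sym in aE; rewrite [s1%:Z + _]addrC.
  apply: (iso_Z2pow_odd hs1 o2 a1 Ee aE) => H expH /(universal_leaf_pres_sym cassini).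
  exact: Kiso.
- have {}Ee : evenfib n = e * 2 + 1 by rewrite Ee; case: eqP.
  have -> : s1%:Z + s2%:Z - 4 = (s1.-2 + s2.-2)%N by lia.
  apply: Kiso.
    apply: has_exponent_pair; first exact/has_exponent_rV/has_exponent_Zp.
    by apply: has_exponent_pair; apply: has_exponent_Zp.
  move: aE ev1 ev2; case: s1 s2 hs1 hs2 => [|[|m1]] [|[|m2]] //= _ _ aE.
  rewrite !negbK => /even_PoszE m1k /even_PoszE m2l.
  exact: (universal_odd_E_even Ee m1k m2l aE (leaf_basis_Z2_Z4_Zp m1 m2 a1)).
Qed.
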